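(* Let $r\ge 2$, let $\chi^2_{m_1},\dots,\chi^2_{m_r},V$ be independent random variables, where $\chi^2_{m_i}$ is chi-square with $m_i$ degrees of freedom and $V$ is chi-square with $\nu$ degrees of freedom ($m_1,\dots,m_r,\nu$ positive integers), let $\alpha_1>\alpha_2>\cdots>\alpha_r>0$, put $|m|=m_1+\cdots+m_r$, and let $$W=\frac{(\alpha_1\chi^2_{m_1}+\cdots+\alpha_r\chi^2_{m_r})/|m|}{V/\nu}.$$ With $a$, $t$, $B_0$, $B_1$, $c_j$ as defined in the context, for an integer $\tau\ge0$ and $y>0$ let $$\widehat H_W(y)=B_0B_1(y)\frac{y}{|m|/2}\sum_{j=0}^{\tau}\frac{\left(\frac{\nu+|m|}{2}\right)_j}{\left(\frac{|m|}{2}+1\right)_j}t(y)^j\sum_{i=0}^{j}c_i .$$ Then $P[W\le y]$ is estimated by $$E_\tau(y)=\widehat H_W(y)+B_0B_1(y)\frac{y}{|m|/2}\,\frac{\left(\frac{\nu+|m|}{2}\right)_{\tau+1}}{\left(\frac{|m|}{2}+1\right)_{\tau+1}}\,t(y)^{\tau+1}\;{}_2F_1\left(\frac{\nu+|m|}{2}+\tau+1,\,1;\,\frac{|m|}{2}+\tau+2;\,t(y)\right)$$ with truncation error bounded by $$e^*_\tau(y)=\left(1-\sum_{i=0}^{\tau+1}c_i\right)B_0B_1(y)\frac{y}{|m|/2}\,\frac{\left(\frac{\nu+|m|}{2}\right)_{\tau+1}}{\left(\frac{|m|}{2}+1\right)_{\tau+1}}\,t(y)^{\tau+1}\;{}_2F_1\left(\frac{\nu+|m|}{2}+\tau+1,\,1;\,\frac{|m|}{2}+\tau+2;\,t(y)\right),$$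 that is, $\left|P[W\le y]-E_\tau(y)\right|\le e^*_\tau(y)$.
   Context: Put $a=\nu\alpha_r/|m|$, $t(y)=y/(a+y)$, $u_i=1-\alpha_r/\alpha_i$ for $1\le i\le r$, $A=\prod_{i=1}^r(\alpha_i/\alpha_r)^{-m_i/2}$, $$B_0=a^{\nu/2}\,\frac{\Gamma\left(\frac{\nu+|m|}{2}\right)}{\Gamma\left(\frac{|m|}{2}\right)\Gamma\left(\frac{\nu}{2}\right)},\qquad B_1(y)=\frac{y^{(|m|-2)/2}}{(a+y)^{(\nu+|m|)/2}}.$$ The coefficients $c_j$ are defined by $A\prod_{i=1}^r(1-u_iz)^{-m_i/2}=\sum_{j=0}^\infty c_jz^j$, which converges absolutely for $|z|<\alpha_1/(\alpha_1-\alpha_r)$; in particular $\sum_{j\ge0}c_j=1$. The Pochhammer symbol is $(b)_j=b(b+1)\cdots(b+j-1)$, $(b)_0=1$, and ${}_2F_1(p,q;s;x)=\sum_{j\ge0}\frac{(p)_j(q)_j}{(s)_j\,j!}x^j$ is the Gauss hypergeometric series. *)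

(* Defs.v *)
From HB Require Import structures.
From mathcomp Require Import all_boot all_order all_algebra.
From mathcomp Require Import all_classical all_reals all_analysis.

Set Implicit Arguments.
Unset Strict Implicit.
Unset Printing Implicit Defensive.

Import Order.TTheory GRing.Theory Num.Theory.
Import numFieldNormedType.Exports.

Local Open Scope classical_set_scope.
Local Open Scope ring_scope.

Definition mutually_independent d (T : measurableType d) (R : realType)
    (P : probability T R) (I : finType) (X : I -> {RV P >-> R}) : Prop :=
  forall (J : {set I}) (S : I -> set R),
    (forall i, i \in J -> measurable (S i)) ->
    P (\bigcap_(i in [set` J]) (X i @^-1` S i)) =
    (\prod_(i in J) P (X i @^-1` S i))%E.

(* Euler's integral, used only at s > 0, where it converges. *)
Definition Gamma (R : realType) (s : R) : R :=
  \int[lebesgue_measure]_(x in `]0, +oo[) (x `^ (s - 1) * expR (- x)).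

Definition chi_square_pdf (R : realType) (k : nat) (x : R) : R :=
  if 0 < x then
    x `^ (k%:R / 2 - 1) * expR (- x / 2) / (2 `^ (k%:R / 2) * Gamma (k%:R / 2))
  else 0.

Definition chi_square_prob (R : realType) (k : nat) (S : set R) : \bar R :=
  (\int[lebesgue_measure]_(x in S) (chi_square_pdf k x)%:E)%E.

Definition is_chi_square d (T : measurableType d) (R : realType)
    (P : probability T R) (k : nat) (X : {RV P >-> R}) : Prop :=
  forall S : set R, measurable S -> distribution P X S = chi_square_prob k S.

Definition pochhammer (R : realType) (b : R) (j : nat) : R :=
  \prod_(0 <= i < j) (b + i%:R).

Definition hypergeo2F1 (R : realType) (p q s x : R) : R :=
  limn (series (fun j => pochhammer p j * pochhammer q j /
                         (pochhammer s j * j`!%:R) * x ^+ j)).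

(* The families alpha_1, ..., alpha_r and m_1, ..., m_r are indexed by 'I_n.+1
   with n.+1 = r, so that alpha ord_max is alpha_r, the smallest alpha_i. *)

Definition total_df (n : nat) (m : 'I_n.+1 -> nat) : nat := (\sum_i m i)%N.

(* The value at a point where V vanishes (a null event) is irrelevant. *)
Definition Wstat (R : realType) (T : Type) (n : nat) (alpha : 'I_n.+1 -> R)
    (m : 'I_n.+1 -> nat) (nu : nat) (X : 'I_n.+1 -> T -> R) (V : T -> R)
    (w : T) : R :=
  ((\sum_i alpha i * X i w) / (total_df m)%:R) / (V w / nu%:R).

Definition coef_a (R : realType) (n : nat) (alpha : 'I_n.+1 -> R)
    (m : 'I_n.+1 -> nat) (nu : nat) : R :=
  nu%:R * alpha ord_max / (total_df m)%:R.

Definition coef_u (R : realType) (n : nat) (alpha : 'I_n.+1 -> R)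
    (i : 'I_n.+1) : R :=
  1 - alpha ord_max / alpha i.

Definition coef_A (R : realType) (n : nat) (alpha : 'I_n.+1 -> R)
    (m : 'I_n.+1 -> nat) : R :=
  \prod_i (alpha i / alpha ord_max) `^ (- (m i)%:R / 2).

(* Only the expansion near 0 is required: it determines c. Convergence on the
   whole disc |z| < alpha_1 / (alpha_1 - alpha_r), which contains 1, and
   sum_j c_j = 1 are consequences. *)
Definition generating_coefs (R : realType) (n : nat) (alpha : 'I_n.+1 -> R)
    (m : 'I_n.+1 -> nat) (c : nat -> R) : Prop :=
  \forall z \near (0 : R),
    series (fun j => c j * z ^+ j) @ \oo -->
    coef_A alpha m * \prod_i (1 - coef_u alpha i * z) `^ (- (m i)%:R / 2).

(* Below, N stands for |m|. *)

Definition tfun (R : realType) (a y : R) : R := y / (a + y).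

Definition B0 (R : realType) (a : R) (N nu : nat) : R :=
  a `^ (nu%:R / 2) *
  (Gamma ((nu%:R + N%:R) / 2) / (Gamma (N%:R / 2) * Gamma (nu%:R / 2))).

Definition B1 (R : realType) (a : R) (N nu : nat) (y : R) : R :=
  y `^ ((N%:R - 2) / 2) / (a + y) `^ ((nu%:R + N%:R) / 2).

Definition prefactor (R : realType) (a : R) (N nu : nat) (y : R) : R :=
  B0 a N nu * B1 a N nu y * (y / (N%:R / 2)).

Definition poch_ratio (R : realType) (N nu j : nat) : R :=
  pochhammer ((nu%:R + N%:R) / 2) j / pochhammer (N%:R / 2 + 1) j.

Definition H_hat (R : realType) (a : R) (N nu : nat) (c : nat -> R)
    (tau : nat) (y : R) : R :=
  prefactor a N nu y *
  \sum_(0 <= j < tau.+1)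
     (poch_ratio R N nu j * tfun a y ^+ j * \sum_(0 <= i < j.+1) c i).

Definition hypergeo_tail (R : realType) (a : R) (N nu tau : nat) (y : R) : R :=
  prefactor a N nu y * poch_ratio R N nu tau.+1 * tfun a y ^+ tau.+1 *
  hypergeo2F1 ((nu%:R + N%:R) / 2 + tau%:R + 1) 1
              (N%:R / 2 + tau%:R + 2) (tfun a y).

Definition E_est (R : realType) (a : R) (N nu : nat) (c : nat -> R)
    (tau : nat) (y : R) : R :=
  H_hat a N nu c tau y + hypergeo_tail a N nu tau y.

Definition e_bound (R : realType) (a : R) (N nu : nat) (c : nat -> R)
    (tau : nat) (y : R) : R :=
  (1 - \sum_(0 <= i < tau.+2) c i) * hypergeo_tail a N nu tau y.

(* Main.v *)
Require Import Defs.
From HB Require Import structures.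
From mathcomp Require Import all_boot all_order all_algebra.
From mathcomp Require Import all_classical all_reals all_analysis.
From mathcomp Require Import measurable_realfun ring lra.

Set Implicit Arguments.
Unset Strict Implicit.
Unset Printing Implicit Defensive.

Import Order.TTheory GRing.Theory Num.Theory.
Import numFieldNormedType.Exports.

Local Open Scope classical_set_scope.
Local Open Scope ring_scope.

(** Put beta_i = alpha_i / alpha_r >= 1, Q = sum_i beta_i X_i and z = y / a. Then
    W = a Q / V, so that W <= y means Q / V <= z.

    The law of Q. The density of beta X, for X chi-square with m degrees of
    freedom, contains e^(-x / (2 beta)) = e^(-x / 2) e^(u x / 2), where
    u = 1 - 1 / beta >= 0. Expanding the second factor in powers of x shows that
    beta X is a mixture of the chi-square laws with m + 2 k degrees of freedom;
    the weights are the Taylor coefficients of beta^(-m/2) (1 - u s)^(-m/2) in s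
    ([chi_square_scale], [nbinom_series]). Degrees of freedom add up under
    convolution ([chi_square_convolution]), so a sum of independent mixtures is a
    mixture whose weights are Cauchy products ([chi_square_mixture_add]). Hence Q
    is a mixture of the chi-square laws with |m| + 2 l degrees of freedom, and its
    weights have the same generating function as the c_l ([chi_square_mixture_sum],
    [sum_weights_series]). By uniqueness of power series coefficients the weights
    are the c_l ([power_series_unique]). In particular the c_l are nonnegative and
    add up to 1.

    The ratio. Let G k be the probability that a chi-square variable with k degrees
    of freedom is at most z V. A chi-square variable with k + 2 degrees of freedom
    is one with k degrees plus an independent exponential one, which yields
    G k = G (k + 2) + D k with an explicit D k ([chi_square_cdf_rec],
    [chi_square_ratio_cdf_rec]). As G k tends to 0, G k is the sum over i of
    D (k + 2 i) ([chi_square_ratio_series]). Inserting this into the mixture and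
    exchanging the sums gives the exact value
      P[W <= y] = sum_k D (|m| + 2 k) (c_0 + ... + c_k)
    ([probability_ratio_le_series]), where D (|m| + 2 k) is the coefficient of
    c_0 + ... + c_k in the series of the statement ([ratio_termE]).

    The bound. The hypergeometric tail is the sum of D (|m| + 2 k) over k > tau
    ([hypergeo_tail_cvg]), so the estimate replaces c_0 + ... + c_k by 1 for these
    k. Each of these partial sums lies between c_0 + ... + c_(tau + 1) and 1, hence
    the error bound ([truncation_bound]). *)

(** * Series *)

Lemma nneseries_EFin (R : realType) (a : nat -> R) (l : R) :
  series a @ \oo --> l -> (\sum_(k <oo) (a k)%:E = l%:E)%E.
Proof.
move=> al; apply/cvg_lim => //.
rewrite (_ : (fun n => _) = EFin \o series a); first by apply: cvg_EFin al; exact: nearW.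
by apply/funext => n /=; rewrite sumEFin.
Qed.

Lemma nneseries_EFin_cvg (R : realType) (a : nat -> R) (l : R) : (forall k, 0 <= a k) ->
  (\sum_(k <oo) (a k)%:E = l%:E)%E -> series a @ \oo --> l.
Proof.
move=> a0 al.
have : (\sum_(0 <= k < n) (a k)%:E)%E @[n --> \oo] --> l%:E.
  by rewrite -al; apply: is_cvg_nneseries => k _ _; rewrite lee_fin.
rewrite (_ : (fun n => _) = EFin \o series a); first by move/fine_cvgP => [].
by apply/funext => n /=; rewrite sumEFin.
Qed.

(** The factor y may be infinite; as an integral against the counting measure the
    series inherits the corresponding property of the integral. *)
Lemma nneseriesZr (R : realType) (a : nat -> \bar R) (y : \bar R) :
  (forall k, 0 <= a k)%E -> (0 <= y)%E ->
  (\sum_(k <oo) (a k * y) = (\sum_(k <oo) a k) * y)%E.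
Proof.
move=> a0 y0; rewrite -!ge0_integral_count//; last by move=> k; rewrite mule_ge0.
by rewrite ge0_integralZr.
Qed.

Lemma nneseries_expR (R : realType) (x : R) :
  (\sum_(k <oo) (x ^+ k / k`!%:R)%:E = (expR x)%:E)%E.
Proof. by apply: nneseries_EFin; exact: is_cvg_series_exp_coeff. Qed.

Lemma cvg_series_telescope (R : realType) (u g : nat -> R) :
  (forall n, g n = g n.+1 + u n) -> g @ \oo --> 0 -> series u @ \oo --> g 0%N.
Proof.
move=> gS g0; rewrite (_ : series u = fun n => g 0%N - g n).
  by rewrite -[X in _ --> X]subr0; apply: cvgB => //; exact: cvg_cst.
apply/funext; elim => [|n IH]; first by rewrite /series/= big_nil subrr.
by rewrite seriesSr IH (gS n); ring.
Qed.

Lemma cvg_series_shift (R : realType) (u : nat -> R) (l : R) n :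
  series u @ \oo --> l ->
  series (fun k => u (n + k)%N) @ \oo --> l - \sum_(0 <= k < n) u k.
Proof.
move=> ul; rewrite (_ : series _ = fun k => series u (k + n)%N - \sum_(0 <= k < n) u k).
  by apply: cvgB; [rewrite cvg_shiftn|exact: cvg_cst].
apply/funext => k; rewrite /series/= (@big_cat_nat _ _ _ n 0 (k + n)%N)//= ?leq_addl//.
rewrite [X in X - _]addrC addrK.
by rewrite -{2}[n]add0n big_addn addnK; apply: eq_bigr => i _; rewrite addnC.
Qed.

Lemma nondecreasing_series_le (R : realType) (u : nat -> R) (l : R) n :
  (forall k, 0 <= u k) -> series u @ \oo --> l -> series u n <= l.
Proof.
move=> u0 ul; rewrite -(cvg_lim _ ul)//; apply: nondecreasing_cvgn_le; last exact/cvgP/ul.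
by apply/nondecreasing_series => k _ _.
Qed.

Definition cauchy_prod (R : realType) (a b : nat -> R) (l : nat) : R :=
  \sum_(0 <= j < l.+1) a j * b (l - j)%N.

Lemma cauchy_prod_ge0 (R : realType) (a b : nat -> R) l :
  (forall k, 0 <= a k) -> (forall k, 0 <= b k) -> 0 <= cauchy_prod a b l.
Proof. by move=> a0 b0; apply: sumr_ge0 => j _; rewrite mulr_ge0. Qed.

Lemma cauchy_prod1r (R : realType) (a : nat -> R) :
  cauchy_prod a (fun l => (l == 0%N)%:R) = a.
Proof.
apply/funext => l; rewrite /cauchy_prod big_nat_recr//= subnn eqxx mulr1.
rewrite big1_seq ?add0r// => j /andP[_]; rewrite mem_index_iota => /andP[_ jl].
by rewrite subn_eq0 leqNgt jl mulr0.
Qed.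

(** With h l = z ^+ l this is the product of two power series; with h l the integral
    of a function against the l-th law of a family stable under convolution it gives
    the convolution of two mixtures. *)
Lemma nneseries_cauchy_prod (R : realType) (a b : nat -> R) (h : nat -> \bar R) :
  (forall k, 0 <= a k) -> (forall k, 0 <= b k) -> (forall k, 0 <= h k)%E ->
  (\sum_(j <oo) ((a j)%:E * \sum_(k <oo) ((b k)%:E * h (j + k)%N)) =
   \sum_(l <oo) ((cauchy_prod a b l)%:E * h l))%E.
Proof.
move=> a0 b0 h0.
pose g j l : \bar R := (if (j <= l)%N then (a j * b (l - j)%N)%:E * h l else 0)%E.
have g0 j l : (0 <= g j l)%E.
  by rewrite /g; case: ifP => // _; rewrite mule_ge0// lee_fin mulr_ge0.
transitivity (\sum_(j <oo) \sum_(l <oo) g j l)%E.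
  apply: eq_eseriesr => j _.
  rewrite -nneseriesZl; last by move=> k _; rewrite mule_ge0// lee_fin.
  rewrite (nneseries_split 0 j)//= add0n big1_seq ?add0e; last first.
    by move=> l /andP[_]; rewrite mem_index_iota /g => /andP[_ lj]; rewrite leqNgt lj.
  rewrite -[RHS]nneseries_addn//; apply: eq_eseriesr => k _.
  by rewrite /g leq_addl addnK EFinM muleA addnC.
rewrite nneseries_interchange//; apply: eq_eseriesr => l _.
rewrite (nneseries_split 0 l.+1)//= add0n eseries0 ?adde0; last first.
  by move=> j lj _; rewrite /g leqNgt lj.
rewrite /cauchy_prod -sumEFin ge0_sume_distrl; last first.
  by move=> j _; rewrite lee_fin mulr_ge0.
rewrite big_nat_cond [RHS]big_nat_cond; apply: eq_bigr => j.
by rewrite andbT ltnS /= /g => ->.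
Qed.

Lemma sum_pow_le (R : realType) (t : R) n : 0 <= t <= 1 / 2 ->
  \sum_(0 <= j < n) t ^+ j.+1 <= 2 * t.
Proof.
move=> /andP[t0 t1]; suff : \sum_(0 <= j < n) t ^+ j.+1 + 2 * t * t ^+ n <= 2 * t.
  by apply: le_trans; rewrite lerDl !mulr_ge0// exprn_ge0.
elim: n => [|n IH]; first by rewrite big_nil add0r expr0 mulr1.
rewrite big_nat_recr//=; apply: le_trans IH; rewrite -addrA lerD2l exprS.
have : 0 <= t * t ^+ n * (1 - 2 * t) by rewrite !mulr_ge0 ?exprn_ge0//; lra.
lra.
Qed.

(** At a fixed z0 the terms are bounded, so at t z0 the terms after the first add up
    to O(t), uniformly in the number of terms; the first one is then O(t) as well. *)
Lemma power_series_coef0 (R : realType) (e : nat -> R) (r : R) : 0 < r ->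
  (forall z, 0 < z < r -> series (fun j => e j * z ^+ j) @ \oo --> (0 : R)) ->
  e 0%N = 0.
Proof.
move=> r0 ez; pose z0 := r / 2; have z00 : 0 < z0 by rewrite divr_gt0.
have cz0 : cvgn (series (fun j => e j * z0 ^+ j)).
  by apply: cvgP; apply: ez; rewrite z00/= /z0; lra.
have [K [Kreal HK]] := cvg_series_bounded cz0.
have {HK} HK j : `|e j * z0 ^+ j| <= `|K| + 1.
  by apply: HK => //; rewrite (le_lt_trans (ler_norm K))// ltrDl.
set L := `|K| + 1 in HK; have L0 : 0 < L by rewrite ltr_wpDl.
apply/eqP; rewrite -normr_le0; apply/ler_addgt0Pr => eps eps0; rewrite add0r.
pose t := Num.min (1 / 2) (eps / (4 * L)).
have t0 : 0 < t by rewrite lt_min divr_gt0//= divr_gt0// mulr_gt0.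
have t1 : t <= 1 / 2 by rewrite ge_min lexx.
have tL : L * (2 * t) <= eps / 2.
  have : t <= eps / (4 * L) by rewrite ge_min lexx orbT.
  by rewrite ler_pdivlMr ?mulr_gt0//; nra.
have tz : 0 < t * z0 < r by rewrite mulr_gt0//= /z0; nra.
have /cvgrPdist_lt /(_ (eps / 2)) := ez _ tz.
have e20 : 0 < eps / 2 by rewrite divr_gt0.
move=> /(_ e20) [n _ /(_ n.+1 (leqnSn n))]; rewrite sub0r normrN /series/= big_nat_recl//.
rewrite expr0 mulr1 => sn.
set s := \sum_(0 <= i < n) _ in sn.
have sL : `|s| <= L * (2 * t).
  apply: le_trans (ler_norm_sum _ _ _) _.
  apply: (@le_trans _ _ (\sum_(0 <= i < n) L * t ^+ i.+1)).
    apply: ler_sum => i _; rewrite exprMn mulrCA normrM mulrC.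
    by apply: ler_pM => //; rewrite ger0_norm// exprn_ge0// ltW.
  rewrite -mulr_sumr ler_wpM2l ?sum_pow_le ?(ltW t0)//; exact: ltW.
have -> : e 0%N = (e 0%N + s) - s by rewrite addrK.
apply: le_trans (ler_normB _ _) _.
by rewrite (splitr eps) lerD// ?(ltW sn)// (le_trans sL).
Qed.

Lemma power_series_eq0 (R : realType) (e : nat -> R) (r : R) : 0 < r ->
  (forall z, 0 < z < r -> series (fun j => e j * z ^+ j) @ \oo --> (0 : R)) ->
  forall k, e k = 0.
Proof.
move=> r0 + k; elim: k e => [|k IH] e ez; first exact: power_series_coef0 r0 ez.
apply: (IH (fun j => e j.+1)) => z zr; have /andP[z0 _] := zr.
have e0 := power_series_coef0 r0 ez.
have := ez z zr; rewrite -(cvg_shiftS _) => h.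
rewrite -(mulr0 z^-1).
rewrite (_ : series _ = fun n => z^-1 * series (fun j => e j * z ^+ j) n.+1).
  exact: cvgMr.
apply/funext => n; rewrite /series/= big_nat_recl// e0 mul0r add0r mulr_sumr.
by apply: eq_bigr => j _; rewrite exprS; field; exact/lt0r_neq0.
Qed.

Lemma power_series_unique (R : realType) (c d : nat -> R) (f : R -> R) :
  (\forall z \near (0 : R), series (fun j => c j * z ^+ j) @ \oo --> f z) ->
  (forall z, 0 <= z < 1 -> series (fun j => d j * z ^+ j) @ \oo --> f z) ->
  c =1 d.
Proof.
move=> [r /= r0 cf] df k; apply/eqP; rewrite -subr_eq0; apply/eqP.
have r1 : 0 < Num.min r 1 by rewrite lt_min r0/=.
apply: (power_series_eq0 (e := fun j => c j - d j) r1) => z; rewrite lt_min => /and3P[z0 zr z1].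
rewrite -(subrr (f z)).
rewrite (_ : series _ = series (fun j => c j * z ^+ j) - series (fun j => d j * z ^+ j)).
  apply: cvgB; [apply: cf => /=; by rewrite sub0r normrN gtr0_norm|by apply: df; rewrite ltW].
apply/funext => n; rewrite /series /= fctE -sumrB.
by apply: eq_bigr => j _; rewrite mulrBl.
Qed.

(** * Lebesgue integrals *)

Lemma measurable_affine (R : realType) (a b : R) :
  measurable_fun [set: R] (fun x => a * x + b : R).
Proof. by apply: measurable_funD => //; exact: measurable_funM. Qed.

(** The image of Lebesgue measure under x |-> a x + b, multiplied by a, agrees with
    Lebesgue measure on intervals. *)
Lemma ge0_integral_affine (R : realType) (f : R -> \bar R) (a b : R) : 0 < a ->
  measurable_fun [set: R] f -> (forall x, 0 <= f x)%E ->
  (\int[lebesgue_measure]_x f x =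
   a%:E * \int[lebesgue_measure]_x f (a * x + b)%R)%E.
Proof.
move=> a0 mf f0.
pose phi (x : R) : measurableTypeR R := a * x + b.
have mphi : measurable_fun [set: measurableTypeR R] phi by exact: measurable_affine.
have E A : measurable A -> lebesgue_measure A =
    mscale (NngNum (ltW a0)) (pushforward (@lebesgue_measure R) phi) A.
  move=> mA; apply: lebesgue_measure_unique => // _ [[c d]] _ <-.
  change (lebesgue_measure `]c, d]%classic =
    a%:E * lebesgue_measure (phi @^-1` `]c, d]%classic))%E.
  have -> : phi @^-1` `]c, d] = `](c - b) / a, (d - b) / a]%classic.
    apply/seteqP; split => x /=; rewrite /phi !in_itv/= ltr_pdivrMr// ler_pdivlMr//.
      by rewrite ltrBlDr lerBrDr mulrC.
    by rewrite ltrBlDr lerBrDr mulrC.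
  rewrite !lebesgue_measure_itv/= !lte_fin ltr_pM2r ?invr_gt0// ltrD2r.
  case: ifP => _; rewrite ?mule0// -!EFinB -EFinM; congr (_%:E).
  by field; rewrite gt_eqF.
rewrite (eq_measure_integral
  (mscale (NngNum (ltW a0)) (pushforward (@lebesgue_measure R) phi)))//=; last first.
  by move=> A mA _; exact: E.
rewrite ge0_integral_mscale//=.
by rewrite ge0_integral_pushforward.
Qed.

(** The density g is almost everywhere the Radon-Nikodym derivative of nu. *)
Lemma ge0_integral_density d (T : measurableType d) (R : realType)
    (nu : {finite_measure set T -> \bar R})
    (mu : {sigma_finite_measure set T -> \bar R}) (g : T -> R) (f : T -> \bar R) :
  measurable_fun [set: T] g -> (forall x, 0 <= g x) ->
  (forall A, measurable A -> nu A = \int[mu]_(x in A) (g x)%:E)%E ->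
  measurable_fun [set: T] f -> (forall x, 0 <= f x)%E ->
  (\int[nu]_x f x = \int[mu]_x ((g x)%:E * f x))%E.
Proof.
move=> mg g0 nuE mf f0.
have numu : nu `<< mu.
  apply/null_content_dominatesP => A mA muA; rewrite nuE//.
  by apply: null_set_integral => //; apply/measurable_EFinP; exact: measurable_funTS.
rewrite -(Radon_Nikodym_SigmaFinite.change_of_variables numu)//.
have mRN := measurable_int _ (Radon_Nikodym_SigmaFinite.f_integrable numu).
under [RHS]eq_integral do rewrite muleC.
apply: ae_eq_integral => //.
- exact: emeasurable_funM.
- by apply: emeasurable_funM => //; exact/measurable_EFinP.
apply: ae_eqe_mul2l.
apply: integral_ae_eq => //.
- exact: Radon_Nikodym_SigmaFinite.f_integrable.
- exact/measurable_EFinP.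
- by move=> A _ mA; rewrite -nuE// -Radon_Nikodym_SigmaFinite.f_integral.
Qed.

Lemma powR_continuous_gt0 (R : realType) (s x : R) : 0 < x ->
  {for x, continuous (fun y : R => y `^ s)}.
Proof.
move=> x0; apply: differentiable_continuous; apply/derivable1_diffP.
by apply: derivable_powR; rewrite in_itv/= x0.
Qed.

Lemma powRVl (R : realType) (a r : R) : 0 <= a -> a^-1 `^ r = a `^ (- r).
Proof. by move=> a0; rewrite -powR_inv1// -powRrM mulN1r. Qed.

(** For s < 1 the integrand is unbounded at 0, so the fundamental theorem of calculus
    is applied on [u n, b] with u n tending to 0. *)
Lemma integral_powR_oc (R : realType) (s b : R) : 0 < s -> 0 < b ->
  (\int[lebesgue_measure]_(x in `]0%R, b]) (x `^ (s - 1))%:E = (b `^ s / s)%:E)%E.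
Proof.
move=> s0 b0.
pose u (n : nat) : R := b / n.+2%:R.
have u0 n : 0 < u n by rewrite divr_gt0.
have ub n : u n < b by rewrite ltr_pdivrMr// ltr_pMr// ltr1n.
have ucvg : u @ \oo --> (0 : R).
  rewrite -(mulr0 b); apply: cvgMr.
  have := @cvg_harmonic R; rewrite -(cvg_shiftn 1) /=.
  by under eq_fun do rewrite addn1.
pose F (n : nat) : set R := `[u n, b]%classic.
have UF : `]0, b]%classic = \bigcup_n F n.
  apply/seteqP; split => [x /=|x [n _] /=]; rewrite /F/= !in_itv/= => /andP[x0 xb].
    have [n _ /(_ n (leqnn _)) un] := cvgr_lt _ ucvg _ x0.
    by exists n => //=; rewrite in_itv/= xb andbT ltW.
  by rewrite xb andbT (lt_le_trans (u0 n)).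
have cF x : 0 < x -> {for x, continuous (fun y : R => y `^ s / s)}.
  by move=> x0; apply: cvgMl; exact: powR_continuous_gt0.
have IF n : (\int[lebesgue_measure]_(x in F n) (x `^ (s - 1))%:E =
    (b `^ s / s - (u n) `^ s / s)%:E)%E.
  rewrite EFinB; apply: (@continuous_FTC2 _ _ (fun x => x `^ s / s)) => //.
  - apply: continuous_in_subspaceT => x; rewrite inE/= in_itv/= => /andP[ux _].
    by apply: powR_continuous_gt0; exact: lt_le_trans ux.
  - split => [x||].
    + rewrite in_itv/= => /andP[ux _].
      by apply: derivableM => //; apply: derivable_powR; rewrite in_itv/= (lt_trans _ ux).
    + by apply: cvg_at_right_filter; exact: cF.
    + by apply: cvg_at_left_filter; exact: cF.
  - move=> x; rewrite in_itv/= => /andP[ux _].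
    have x0 : 0 < x by exact: lt_trans ux.
    rewrite derive1Mr ?powR_derive1 ?in_itv/= ?x0//.
      by rewrite mulrC mulrA mulVf ?mul1r// gt_eqF.
    by apply: derivable_powR; rewrite in_itv/= x0.
have L : (\int[lebesgue_measure]_(x in F n) (x `^ (s - 1))%:E @[n --> \oo] -->
    (b `^ s / s)%:E)%E.
  under eq_fun do rewrite IF.
  apply: cvg_EFin; first exact: nearW.
  rewrite -[X in _ --> X]subr0; apply: cvgB; first exact: cvg_cst.
  rewrite -(mul0r s^-1); apply: cvgMl.
  exact: ((cvg_at_rightP (fun a => a `^ s) 0 0).1 (powR_cvg0 s0) u).
have mF n : measurable (F n) by exact: measurable_itv.
rewrite -(cvg_lim _ L)//; apply/esym/cvg_lim => //; rewrite UF.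
apply: ge0_nondecreasing_set_cvg_integral => //.
- move=> n k nk; apply/subsetPset => x; rewrite /F/= !in_itv/= => /andP[ux ->].
  rewrite andbT (le_trans _ ux)// ler_pM2l// lef_pV2 ?posrE ?ltr0n//.
  by rewrite ler_nat !ltnS.
- by move=> n; apply: measurable_funTS; apply/measurable_EFinP; exact: measurable_powR.
- by move=> n x _; rewrite lee_fin powR_ge0.
Qed.

Lemma integral_expRN_ge (R : realType) (t : R) :
  (\int[lebesgue_measure]_s (if t <= s then expR (- s) else 0)%:E = (expR (- t))%:E)%E.
Proof.
rewrite (@ge0_integral_affine _
  (fun s : R => (if t <= s then expR (- s) else 0)%:E) 1 t)//; last 2 first.
- apply/measurable_EFinP; apply: measurable_fun_ifT => //.
    exact: measurable_fun_ler.
  exact: measurableT_comp.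
- by move=> s; rewrite lee_fin; case: ifP => // _; rewrite expR_ge0.
rewrite mul1e.
transitivity (\int[lebesgue_measure]_s ((expR (- t))%:E * (exponential_pdf 1 s)%:E))%E.
  apply: eq_integral => s _; rewrite -EFinM; congr (_%:E).
  rewrite mul1r lerDr; case: ifPn => s0; last by rewrite lt0_exponential_pdf ?mulr0// ltNge.
  by rewrite exponential_pdfE// mul1r -expRD mulN1r opprD addrC.
rewrite ge0_integralZl//=.
- by rewrite integral_exponential_pdf// mule1.
- by apply/measurable_EFinP; exact: measurable_exponential_pdf.
- by move=> s _; rewrite lee_fin exponential_pdf_ge0.
Qed.

(** * The Gamma function *)

(** Zero off the positive half-line, so that integrals can range over the whole line
    and affine changes of variable leave the domain alone. *)
Definition gamma_kernel (R : realType) (s b x : R) : R :=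
  if 0 < x then x `^ (s - 1) * expR (- (b * x)) else 0.

Lemma gamma_kernel_ge0 (R : realType) (s b x : R) : 0 <= gamma_kernel s b x.
Proof. by rewrite /gamma_kernel; case: ifP => // _; rewrite mulr_ge0 ?powR_ge0 ?expR_ge0. Qed.

Lemma measurable_gamma_kernel (R : realType) (s b : R) :
  measurable_fun [set: R] (gamma_kernel s b).
Proof.
apply: measurable_fun_ifT => //; first exact: measurable_fun_ltr.
apply: measurable_funM; first exact: measurable_powR.
apply: measurableT_comp => //; apply: measurableT_comp => //.
Qed.

Lemma gamma_kernel_scale (R : realType) (s a b x : R) : 0 < a ->
  gamma_kernel s b (a * x) = a `^ (s - 1) * gamma_kernel s (b * a) x.
Proof.
move=> a0; rewrite /gamma_kernel pmulr_rgt0//; case: ifP => x0; last by rewrite mulr0.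
by rewrite powRM ?ltW// !mulrA.
Qed.

Lemma integral_gamma_kernel_itv (R : realType) (s : R) :
  (\int[lebesgue_measure]_x (gamma_kernel s 1 x)%:E =
   \int[lebesgue_measure]_(x in `]0%R, +oo[) (x `^ (s - 1) * expR (- x))%:E)%E.
Proof.
rewrite [RHS]integral_mkcond; apply: eq_integral => x _.
rewrite patchE /gamma_kernel; case: ifPn => [x0|].
  by rewrite mem_set ?mul1r// /= in_itv/= x0.
by move=> x0; rewrite memNset// /= in_itv/= andbT; exact/negP.
Qed.

(** The kernel is at most x^(s - 1) on ]0, 1] and at most a multiple of e^(-x / 2)
    beyond 1, where x^(s - 1) <= x^(n + 1) for n the integer part of s. *)
Lemma gamma_kernel_lty (R : realType) (s : R) : 0 < s ->
  (\int[lebesgue_measure]_x (gamma_kernel s 1 x)%:E < +oo)%E.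
Proof.
move=> s0.
pose n := Num.truncn s.
pose K : R := 2 ^+ n.+1 * n.+1`!%:R.
have K0 : 0 < K by rewrite mulr_gt0 ?exprn_gt0 ?ltr0n ?fact_gt0.
pose g1 (x : R) : R := ((fun x => x `^ (s - 1)) \_ `]0, 1]) x.
pose g2 (x : R) : R := 2 * K * exponential_pdf (1 / 2) x.
have mg1 : measurable_fun [set: R] g1.
  apply: (measurable_restrict _ _ _).1 => //.
  by apply: measurable_funTS; exact: measurable_powR.
have mg2 : measurable_fun [set: R] g2.
  by apply: measurable_funM => //; exact: measurable_exponential_pdf.
have g10 x : 0 <= g1 x by rewrite /g1 patchE; case: ifP => // _; exact: powR_ge0.
have g20 x : 0 <= g2 x by rewrite mulr_ge0 ?exponential_pdf_ge0// mulr_ge0// ltW.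
have le12 x : gamma_kernel s 1 x <= g1 x + g2 x.
  rewrite /gamma_kernel; case: ifPn => x0; last by rewrite addr_ge0.
  rewrite mul1r; have [x1|x1] := leP x 1.
    rewrite -[leLHS]addr0 lerD// /g1 patchE mem_set/= ?in_itv/= ?x0//.
    by rewrite ler_piMr ?powR_ge0// -expR0 ler_expR oppr_le0 ltW.
  rewrite -[leLHS]add0r lerD// /g2 exponential_pdfE; last exact: ltW.
  have -> : 2 * K * (1 / 2 * expR (- (1 / 2) * x)) = K * expR (x / 2) * expR (- x).
    rewrite -[RHS]mulrA -expRD; have -> : x / 2 - x = - (1 / 2) * x by lra.
    lra.
  rewrite ler_pM2r ?expR_gt0//.
  apply: (@le_trans _ _ (x ^+ n.+1)).
    rewrite -powR_mulrn; last exact: ltW.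
    apply: ler_powR; first exact: ltW.
    have := truncnS_gt s; rewrite -/n; lra.
  have x2 : 0 <= x / 2 by lra.
  have : (x / 2) ^+ n.+1 / n.+1`!%:R <= expR (x / 2).
    by apply: le_trans (expR_ge1Dxn n x2); rewrite lerDr.
  rewrite -(ler_pM2l K0); apply: le_trans.
  rewrite (_ : K * _ = x ^+ n.+1)// /K expr_div_n; field.
  by rewrite expf_neq0//= pnatr_eq0 -lt0n fact_gt0.
apply: (@le_lt_trans _ _ (\int[lebesgue_measure]_x ((g1 x)%:E + (g2 x)%:E)))%E.
  apply: ge0_le_integral => //=.
  - by move=> x _; rewrite lee_fin gamma_kernel_ge0.
  - by apply/measurable_EFinP; exact: measurable_gamma_kernel.
  - by apply/emeasurable_funD; exact/measurable_EFinP.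
  - by move=> x _; rewrite -EFinD lee_fin.
rewrite ge0_integralD//=; last 4 first.
- by move=> x _; rewrite lee_fin.
- exact/measurable_EFinP.
- by move=> x _; rewrite lee_fin.
- exact/measurable_EFinP.
rewrite lte_add_pinfty//.
  rewrite (_ : integral _ _ _ =
      (\int[lebesgue_measure]_(x in `]0%R, 1%R]) (x `^ (s - 1))%:E)%E).
    by rewrite integral_powR_oc// ltry.
  rewrite [RHS]integral_mkcond; apply: eq_integral => x _.
  by rewrite /g1 !patchE; case: ifP.
under eq_integral do rewrite /g2 EFinM.
rewrite ge0_integralZl//=.
- by rewrite integral_exponential_pdf// mule1 ltry.
- by apply/measurable_EFinP; exact: measurable_exponential_pdf.
- by move=> x _; rewrite lee_fin exponential_pdf_ge0.
- by rewrite lee_fin mulr_ge0// ltW.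
Qed.

Lemma gamma_kernel_integral_gt0 (R : realType) (s : R) : 0 < s ->
  (0 < \int[lebesgue_measure]_x (gamma_kernel s 1 x)%:E)%E.
Proof.
move=> s0; pose c : R := expR (- 2) / 2.
have c0 : 0 < c by rewrite divr_gt0// expR_gt0.
apply: (@lt_le_trans _ _ (\int[lebesgue_measure]_(x in `[1%R, 2%R]) c%:E)%E).
  rewrite integral_cst//= lebesgue_measure_itv/= lte_fin ltr1n -EFinD -EFinM lte_fin.
  by rewrite mulr_gt0//; lra.
rewrite integral_mkcond; apply: ge0_le_integral => //=.
- by move=> x _; rewrite patchE; case: ifP => // _; rewrite lee_fin ltW.
- by apply: (measurable_restrict _ _ _).1.
- by apply/measurable_EFinP; exact: measurable_gamma_kernel.
move=> x _; rewrite patchE; case: ifPn => [|_]; last by rewrite lee_fin gamma_kernel_ge0.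
rewrite inE/= in_itv/= => /andP[x1 x2]; have x0 : 0 < x by lra.
rewrite lee_fin /gamma_kernel x0 mul1r /c mulrC.
apply: ler_pM; rewrite ?invr_ge0 ?expR_ge0 ?ler_expR ?lerN2//.
have := @mulr_powRB1 R x s (ltW x0) s0.
have : 1 <= x `^ s by rewrite -(powRr0 x); apply: ler_powR => //; exact: ltW.
have := @powR_ge0 R x (s - 1); nra.
Qed.

Lemma Gamma_kernelE (R : realType) (s : R) : 0 < s ->
  (\int[lebesgue_measure]_x (gamma_kernel s 1 x)%:E = (Gamma s)%:E)%E.
Proof.
move=> s0; rewrite /Gamma /Rintegral -integral_gamma_kernel_itv fineK//.
by rewrite ge0_fin_numE ?gamma_kernel_lty// ltW// gamma_kernel_integral_gt0.
Qed.

Lemma Gamma_gt0 (R : realType) (s : R) : 0 < s -> 0 < Gamma s.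
Proof. by move=> s0; rewrite -lte_fin -Gamma_kernelE// gamma_kernel_integral_gt0. Qed.

Lemma Gamma_ge0 (R : realType) (s : R) : 0 <= Gamma s.
Proof.
apply: Rintegral_ge0 => x _; by rewrite mulr_ge0 ?powR_ge0 ?expR_ge0.
Qed.

Lemma integral_gamma_kernel (R : realType) (s b : R) : 0 < s -> 0 < b ->
  (\int[lebesgue_measure]_x (gamma_kernel s b x)%:E = (b `^ (- s) * Gamma s)%:E)%E.
Proof.
move=> s0 b0; rewrite EFinM -Gamma_kernelE//.
rewrite (@ge0_integral_affine _ (EFin \o gamma_kernel s 1) b 0 b0)/=; last 2 first.
- by apply/measurable_EFinP; exact: measurable_gamma_kernel.
- by move=> x; rewrite lee_fin gamma_kernel_ge0.
under [in RHS]eq_integral do rewrite addr0 gamma_kernel_scale// mul1r EFinM.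
rewrite ge0_integralZl//=; last 3 first.
- by apply/measurable_EFinP; exact: measurable_gamma_kernel.
- by move=> x _; rewrite lee_fin gamma_kernel_ge0.
- by rewrite lee_fin powR_ge0.
rewrite !muleA -!EFinM -mulrA mulr_powRB1 ?ltW// -powRD.
  by rewrite addNr powRr0 mul1e.
by rewrite (gt_eqF b0) implybT.
Qed.

(** Both sides come from integrating t^(s - 1) e^(-x) over the wedge 0 < t <= x, in
    the two orders. *)
Lemma GammaS (R : realType) (s : R) : 0 < s -> Gamma (s + 1) = s * Gamma s.
Proof.
move=> s0.
pose f (z : R * R) : R :=
  if (0 < z.2) && (z.2 <= z.1) then z.2 `^ (s - 1) * expR (- z.1) else 0.
have f0 z : 0 <= f z.
  by rewrite /f; case: ifP => // _; rewrite mulr_ge0 ?powR_ge0 ?expR_ge0.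
have mf : measurable_fun [set: R * R] f.
  apply: measurable_fun_ifT => //.
    by apply: measurable_and; [exact: measurable_fun_ltr|exact: measurable_fun_ler].
  apply: measurable_funM; first by apply: measurableT_comp (measurable_powR _) _.
  by apply: measurableT_comp => //; exact: measurableT_comp.
have := fubini_tonelli (m1 := @lebesgue_measure R) (m2 := @lebesgue_measure R) (EFin \o f).
have -> : (\int[lebesgue_measure]_x \int[lebesgue_measure]_y (EFin \o f) (x, y) =
    (s^-1 * Gamma (s + 1))%:E)%E.
  rewrite EFinM -Gamma_kernelE ?addr_gt0// -ge0_integralZl//=; last 3 first.
  - by apply/measurable_EFinP; exact: measurable_gamma_kernel.
  - by move=> x _; rewrite lee_fin gamma_kernel_ge0.
  - by rewrite lee_fin invr_ge0 ltW.
  apply: eq_integral => x _; rewrite /gamma_kernel addrK mul1r; case: ifPn => x0.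
    transitivity (\int[lebesgue_measure]_(y in `]0%R, x])
        ((expR (- x))%:E * (y `^ (s - 1))%:E))%E.
      rewrite [RHS]integral_mkcond; apply: eq_integral => y _; rewrite patchE /f/=.
      by rewrite mem_setE in_itv/=; case: ifP => //; rewrite mulrC.
    rewrite ge0_integralZl//=; last 2 first.
    - by apply/measurable_EFinP; apply: measurable_funTS; exact: measurable_powR.
    - by move=> y _; rewrite lee_fin powR_ge0.
    by rewrite integral_powR_oc// -!EFinM; congr (_%:E); ring.
  rewrite mule0 integral0_eq// => y _; rewrite /f/=; case: ifP => // /andP[y0 yx].
  by rewrite (lt_le_trans y0 yx) in x0.
have -> : (\int[lebesgue_measure]_y \int[lebesgue_measure]_x (EFin \o f) (x, y) =
    (Gamma s)%:E)%E.
  rewrite -Gamma_kernelE//; apply: eq_integral => y _; rewrite /gamma_kernel mul1r.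
  case: ifPn => y0; last first.
    by rewrite integral0_eq// => x _; rewrite /f/= (negPf y0).
  rewrite EFinM -integral_expRN_ge -ge0_integralZl//=; last 3 first.
  - apply/measurable_EFinP; apply: measurable_fun_ifT => //.
      exact: measurable_fun_ler.
    exact: measurableT_comp.
  - by move=> x _; rewrite lee_fin; case: ifP => // _; rewrite expR_ge0.
  - by rewrite lee_fin powR_ge0.
  by apply: eq_integral => x _; rewrite /f/= y0/=; case: ifP; rewrite ?mule0.
move=> h; have : (s^-1 * Gamma (s + 1))%:E = (Gamma s)%:E.
  by apply: h => //; exact/measurable_EFinP.
by move=> [<-]; rewrite mulVKf// gt_eqF.
Qed.

Lemma pochhammerS (R : realType) (b : R) j : pochhammer b j.+1 = pochhammer b j * (b + j%:R).
Proof. by rewrite /pochhammer big_nat_recr. Qed.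

Lemma pochhammer_gt0 (R : realType) (b : R) j : 0 < b -> 0 < pochhammer b j.
Proof.
move=> b0; elim: j => [|j IH]; first by rewrite /pochhammer big_nil.
by rewrite pochhammerS mulr_gt0// ltr_wpDr// ler0n.
Qed.

Lemma pochhammerD (R : realType) (b : R) i j :
  pochhammer b (i + j) = pochhammer b i * pochhammer (b + i%:R) j.
Proof.
elim: j => [|j IH]; first by rewrite addn0 /pochhammer big_nil mulr1.
by rewrite addnS !pochhammerS IH natrD; ring.
Qed.

Lemma pochhammer1 (R : realType) j : pochhammer (1 : R) j = j`!%:R.
Proof.
elim: j => [|j IH]; first by rewrite /pochhammer big_nil.
by rewrite pochhammerS IH factS natrM mulrC nat1r.
Qed.

Lemma Gamma_pochhammer (R : realType) (b : R) j : 0 < b ->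
  Gamma (b + j%:R) = Gamma b * pochhammer b j.
Proof.
move=> b0; elim: j => [|j IH]; first by rewrite addr0 /pochhammer big_nil mulr1.
rewrite -natr1 addrA GammaS ?IH ?pochhammerS; first by ring.
by rewrite ltr_wpDr// ler0n.
Qed.

(** After the substitution x = s v the product of the kernels at x and s - x is a
    power of s times e^(-b s) times a function of v alone. Its integral over v, the
    Beta integral B, is left as an extended real: total mass determines it in
    [chi_square_convolution]. *)
Lemma gamma_kernel_convolution (R : realType) (p q b : R) :
  exists B : \bar R, (0 <= B)%E /\
  forall f : R -> \bar R, measurable_fun [set: R] f -> (forall x, 0 <= f x)%E ->
  (\int[lebesgue_measure]_x ((gamma_kernel p b x)%:E *
      \int[lebesgue_measure]_y ((gamma_kernel q b y)%:E * f (x + y)%R)) =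
   B * \int[lebesgue_measure]_x ((gamma_kernel (p + q) b x)%:E * f x))%E.
Proof.
pose beta (v : R) : R := gamma_kernel p 0 v * gamma_kernel q 0 (1 - v).
have beta0 v : 0 <= beta v by rewrite mulr_ge0 ?gamma_kernel_ge0.
have mker r c := measurable_gamma_kernel (R := R) r c.
have mker2 r c x : measurable_fun [set: R] (fun y => gamma_kernel r c (x - y)).
  by apply: measurableT_comp; [exact: mker|exact: measurable_funB].
have mbeta : measurable_fun [set: R] beta.
  by apply: measurable_funM; [exact: mker|exact: mker2].
exists (\int[lebesgue_measure]_v (beta v)%:E)%E; split.
  by apply: integral_ge0 => v _; rewrite lee_fin.
move=> f mf f0.
pose h (z : R * R) : \bar R :=
  ((gamma_kernel p b z.1 * gamma_kernel q b (z.2 - z.1))%:E * f z.2)%E.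
have h0 z : (0 <= h z)%E by rewrite mule_ge0// lee_fin mulr_ge0// gamma_kernel_ge0.
have mh : measurable_fun [set: R * R] h.
  apply: emeasurable_funM; last exact: measurableT_comp.
  apply/measurable_EFinP; apply: measurable_funM; apply: measurableT_comp => //.
  exact: measurable_funB.
transitivity (\int[lebesgue_measure]_x \int[lebesgue_measure]_s h (x, s))%E.
  apply: eq_integral => x _.
  rewrite (@ge0_integral_affine _ (fun s => h (x, s)) 1 x)//; last exact: measurableT_comp.
  rewrite mul1e -ge0_integralZl//=; last 3 first.
  - apply: emeasurable_funM; first by apply/measurable_EFinP; exact: mker.
    by apply: measurableT_comp => //; exact: measurable_funD.
  - by move=> y _; rewrite mule_ge0// lee_fin gamma_kernel_ge0.
  - by rewrite lee_fin gamma_kernel_ge0.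
  by apply: eq_integral => y _; rewrite /h/= mul1r addrK EFinM muleA (addrC x).
rewrite fubini_tonelli// -ge0_integralZl//=; last 3 first.
- by apply: emeasurable_funM => //; apply/measurable_EFinP; exact: mker.
- by move=> x _; rewrite mule_ge0// lee_fin gamma_kernel_ge0.
- by apply: integral_ge0 => v _; rewrite lee_fin.
apply: eq_integral => s _.
pose k x := (gamma_kernel p b x * gamma_kernel q b (s - x))%:E.
transitivity ((\int[lebesgue_measure]_x k x) * f s)%E.
  rewrite -ge0_integralZr//=.
  - by apply/measurable_EFinP; apply: measurable_funM; [exact: mker|exact: mker2].
  - by move=> x _; rewrite lee_fin mulr_ge0// gamma_kernel_ge0.
rewrite muleA; congr (_ * _)%E.
have [s0|s0] := ltP 0 s; last first.
  have -> : gamma_kernel (p + q) b s = 0 by rewrite /gamma_kernel ltNge s0.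
  rewrite mule0 integral0_eq// => x _.
  rewrite /k /gamma_kernel; case: ifP => x0; last by rewrite mul0r.
  rewrite subr_gt0; case: ifP => sx0; last by rewrite mulr0.
  by move: (lt_trans x0 sx0); rewrite ltNge s0.
rewrite (@ge0_integral_affine _ k s 0 s0)/=; last 2 first.
- by apply/measurable_EFinP; apply: measurable_funM; [exact: mker|exact: mker2].
- by move=> x; rewrite lee_fin mulr_ge0// gamma_kernel_ge0.
have E v : gamma_kernel p b (s * v + 0) * gamma_kernel q b (s - (s * v + 0)) =
    s^-1 * gamma_kernel (p + q) b s * beta v.
  rewrite addr0 -{2}(mulr1 s) -mulrBr !gamma_kernel_scale// /beta /gamma_kernel s0.
  case: ifP => v0; last by rewrite mulr0 !mul0r mulr0.
  case: ifP => v1; last by rewrite !mulr0.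
  rewrite !mul0r oppr0 expR0 !mulr1.
  have -> : p + q - 1 = (p - 1) + (q - 1) + 1 by ring.
  rewrite (@powRD _ s (p - 1 + (q - 1)) 1) ?(gt_eqF s0) ?implybT//.
  rewrite (@powRD _ s (p - 1) (q - 1)) ?(gt_eqF s0) ?implybT// powRr1 ?ltW//.
  have -> : - (b * s) = - (b * s * v) + - (b * s * (1 - v)) by ring.
  rewrite expRD; field; exact/lt0r_neq0.
under eq_integral do rewrite /k E EFinM.
rewrite ge0_integralZl//=; last 3 first.
- exact/measurable_EFinP.
- by move=> x _; rewrite lee_fin.
- by rewrite lee_fin mulr_ge0 ?invr_ge0 ?gamma_kernel_ge0// ltW.
by rewrite muleA -EFinM mulVKf ?lt0r_neq0// muleC.
Qed.

(** * Chi-square densities *)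

Lemma chi_square_pdfE (R : realType) k (x : R) : chi_square_pdf k x =
  (2 `^ (k%:R / 2) * Gamma (k%:R / 2))^-1 * gamma_kernel (k%:R / 2) (1 / 2) x.
Proof.
rewrite /chi_square_pdf /gamma_kernel; case: ifP => _; last by rewrite mulr0.
by rewrite mulrC; congr (_ * (_ * expR _)); field.
Qed.

Lemma chi_square_pdf_ge0 (R : realType) k (x : R) : 0 <= chi_square_pdf k x.
Proof.
by rewrite chi_square_pdfE mulr_ge0 ?gamma_kernel_ge0// invr_ge0 mulr_ge0 ?powR_ge0 ?Gamma_ge0.
Qed.

Lemma measurable_chi_square_pdf (R : realType) k :
  measurable_fun [set: R] (chi_square_pdf k).
Proof.
rewrite (_ : chi_square_pdf k = fun x => (2 `^ (k%:R / 2) * Gamma (k%:R / 2))^-1 *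
    gamma_kernel (k%:R / 2) (1 / 2) x); last by apply/funext => x; exact: chi_square_pdfE.
by apply: measurable_funM => //; exact: measurable_gamma_kernel.
Qed.

Lemma measurable_chi_square_pdf_mule (R : realType) k (f : R -> \bar R) :
  measurable_fun [set: R] f ->
  measurable_fun [set: R] (fun x => (chi_square_pdf k x)%:E * f x)%E.
Proof.
move=> mf; apply: emeasurable_funM => //.
by apply/measurable_EFinP; exact: measurable_chi_square_pdf.
Qed.

Lemma chi_square_laplace (R : realType) k (t : R) : (0 < k)%N -> - (1 / 2) < t ->
  (\int[lebesgue_measure]_x ((chi_square_pdf k x)%:E * (expR (- (t * x)))%:E) =
   ((1 + 2 * t) `^ (- (k%:R / 2)))%:E)%E.
Proof.
move=> k0 t0.
have s0 : 0 < k%:R / 2 :> R by rewrite divr_gt0// ltr0n.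
have b0 : 0 < 1 / 2 + t by lra.
transitivity (\int[lebesgue_measure]_x (((2 `^ (k%:R / 2) * Gamma (k%:R / 2))^-1)%:E *
    (gamma_kernel (k%:R / 2) (1 / 2 + t) x)%:E))%E.
  apply: eq_integral => x _; rewrite -!EFinM chi_square_pdfE -mulrA; congr (_ * _)%:E.
  rewrite /gamma_kernel; case: ifP => _; last by rewrite mul0r.
  by rewrite -mulrA -expRD mulrDl opprD.
rewrite ge0_integralZl//=; last 3 first.
- by apply/measurable_EFinP; exact: measurable_gamma_kernel.
- by move=> x _; rewrite lee_fin gamma_kernel_ge0.
- by rewrite lee_fin invr_ge0 mulr_ge0 ?powR_ge0 ?Gamma_ge0.
rewrite integral_gamma_kernel// -EFinM; congr (_%:E).
have -> : 1 + 2 * t = 2 * (1 / 2 + t) by field.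
rewrite powRM ?ltW// [2 `^ (- _)]powRN.
have G0 := Gamma_gt0 s0; have P0 : 0 < 2 `^ (k%:R / 2) :> R by rewrite powR_gt0.
by field; rewrite !gt_eqF.
Qed.

Lemma integral_chi_square_pdf (R : realType) k : (0 < k)%N ->
  (\int[lebesgue_measure]_x (chi_square_pdf k x)%:E = 1 :> \bar R)%E.
Proof.
move=> k0; have := @chi_square_laplace R k 0 k0.
under eq_integral do rewrite mul0r oppr0 expR0 mule1.
by rewrite mulr0 addr0 powR1; apply; lra.
Qed.

(** By [gamma_kernel_convolution] the two sides differ by a constant factor K; it is 1
    because both sides are 1 for f = 1. *)
Lemma chi_square_convolution (R : realType) j k (f : R -> \bar R) :
  (0 < j)%N -> (0 < k)%N ->
  measurable_fun [set: R] f -> (forall x, 0 <= f x)%E ->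
  (\int[lebesgue_measure]_x ((chi_square_pdf j x)%:E *
      \int[lebesgue_measure]_y ((chi_square_pdf k y)%:E * f (x + y)%R)) =
   \int[lebesgue_measure]_x ((chi_square_pdf (j + k) x)%:E * f x))%E.
Proof.
move=> j0 k0.
pose C (l : nat) : R := 2 `^ (l%:R / 2) * Gamma (l%:R / 2).
have C0 l : (0 < l)%N -> 0 < C l.
  by move=> l0; rewrite mulr_gt0 ?powR_gt0 ?Gamma_gt0// divr_gt0// ltr0n.
have C1 l : 0 <= (C l)^-1 by rewrite invr_ge0 mulr_ge0 ?powR_ge0 ?Gamma_ge0.
pose g l := @gamma_kernel R (l%:R / 2) (1 / 2).
have mgf l (h : R -> \bar R) : measurable_fun [set: R] h ->
    measurable_fun [set: R] (fun x => (g l x)%:E * h x)%E.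
  move=> mh; apply: emeasurable_funM => //.
  by apply/measurable_EFinP; exact: measurable_gamma_kernel.
have gf0 l x (v : \bar R) : (0 <= v)%E -> (0 <= (g l x)%:E * v)%E.
  by move=> v0; rewrite mule_ge0// lee_fin gamma_kernel_ge0.
have pull l (h : R -> \bar R) : measurable_fun [set: R] h -> (forall x, 0 <= h x)%E ->
    (\int[lebesgue_measure]_x ((chi_square_pdf l x)%:E * h x) =
     ((C l)^-1)%:E * \int[lebesgue_measure]_x ((g l x)%:E * h x))%E.
  move=> mh h0; rewrite -ge0_integralZl//=; last 3 first.
  - exact: mgf.
  - by move=> x _; exact: gf0.
  - by rewrite lee_fin C1.
  by apply: eq_integral => x _; rewrite chi_square_pdfE EFinM muleA.
have regroup (a b c : R) (u v : \bar R) : c != 0 ->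
    (a%:E * (b%:E * (u * v)) = (b * a * c)%:E * u * ((c^-1)%:E * v))%E.
  move=> c0; rewrite [RHS]muleACA -(EFinM (b * a * c)) mulfK// mulrC EFinM.
  by rewrite -[RHS]muleA.
have [B [B0 convB]] := @gamma_kernel_convolution R (j%:R / 2) (k%:R / 2) (1 / 2).
have [K key] : exists K : \bar R, forall h : R -> \bar R,
    measurable_fun [set: R] h -> (forall x, 0 <= h x)%E ->
    (\int[lebesgue_measure]_x ((chi_square_pdf j x)%:E *
      \int[lebesgue_measure]_y ((chi_square_pdf k y)%:E * h (x + y)%R)) =
    K * \int[lebesgue_measure]_x ((chi_square_pdf (j + k) x)%:E * h x))%E.
  exists (((C j)^-1 * (C k)^-1 * C (j + k)%N)%:E * B)%E => h mh h0.
  have mh2 x : measurable_fun [set: R] (fun y => h (x + y)).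
    by apply: measurableT_comp => //; exact: measurable_funD.
  have mI : measurable_fun [set: R] (fun x =>
      \int[lebesgue_measure]_y ((g k y)%:E * h (x + y)%R))%E.
    apply: (@measurable_fun_fubini_tonelli_F _ _ _ _ _ lebesgue_measure
      (fun z : R * R => (g k z.2)%:E * h (z.1 + z.2)%R)%E).
      2: by move=> z; exact: gf0.
    apply: emeasurable_funM.
      by apply/measurable_EFinP; apply: measurableT_comp => //; exact: measurable_gamma_kernel.
    by apply: measurableT_comp => //; exact: measurable_funD.
  under eq_integral do rewrite (pull k)// muleCA.
  have I0 x : (0 <= \int[lebesgue_measure]_y ((g k y)%:E * h (x + y)%R))%E.
    by apply: integral_ge0 => y _; exact: gf0.
  rewrite ge0_integralZl//=; last 3 first.
  - exact: measurable_chi_square_pdf_mule.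
  - by move=> x _; rewrite mule_ge0// lee_fin chi_square_pdf_ge0.
  - by rewrite lee_fin C1.
  rewrite (pull j)// convB// (pull (j + k)%N)// -mulrDl -natrD.
  apply: regroup; exact/lt0r_neq0/C0/ltn_addr.
move=> mf f0; rewrite key//.
have one l : (0 < l)%N ->
    (\int[lebesgue_measure]_x ((chi_square_pdf l x)%:E * cst 1 x) = 1 :> \bar R)%E.
  move=> l0; rewrite -[RHS](integral_chi_square_pdf R l0).
  by apply: eq_integral => x _; exact: mule1.
have K1 : (K = 1)%E.
  rewrite -[LHS]mule1 -[X in (K * X)%E](one (j + k)%N) ?addn_gt0 ?j0// -key// -[RHS](one j)//.
  by apply: eq_integral => x _; congr (_ * _)%E; exact: one.
by rewrite K1 mul1e.
Qed.

(** Coefficient of z^k in (1 - u z)^(-p), with (p)_k written as a quotient of values of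
    Gamma, the form in which it comes out of the chi-square densities. *)
Definition nbinom_coef (R : realType) (p u : R) (k : nat) : R :=
  Gamma (p + k%:R) / (Gamma p * k`!%:R) * u ^+ k.

Lemma nbinom_coef_ge0 (R : realType) (p u : R) k : 0 <= u -> 0 <= nbinom_coef p u k.
Proof.
by move=> u0; rewrite mulr_ge0 ?exprn_ge0// divr_ge0 ?mulr_ge0 ?Gamma_ge0.
Qed.

(** The factor e^(-x / (2 beta)) of the scaled density is e^(-x / 2) times the power
    series of e^((1 - 1 / beta) x / 2), and each term of the product is proportional
    to a chi-square density. *)
Lemma chi_square_scale_pdf (R : realType) m (beta x : R) : (0 < m)%N -> 1 <= beta ->
  ((beta^-1 * chi_square_pdf m (beta^-1 * x))%:E =
   \sum_(k <oo) (beta `^ (- (m%:R / 2)) * nbinom_coef (m%:R / 2) (1 - beta^-1) k *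
     chi_square_pdf (m + k.*2) x)%:E)%E.
Proof.
move=> m0 b1; have b0 : 0 < beta by exact: lt_le_trans b1.
have bi0 : 0 < beta^-1 by rewrite invr_gt0.
have u0 : 0 <= 1 - beta^-1 by rewrite subr_ge0 invf_le1.
set p := m%:R / 2; have p0 : 0 < p by rewrite divr_gt0// ltr0n.
have [x0|x0] := ltP 0 x; last first.
  rewrite chi_square_pdfE /gamma_kernel pmulr_rgt0// ltNge x0/= !mulr0 eseries0// => k _ _.
  by rewrite /chi_square_pdf ltNge x0/= mulr0.
have pk0 k : 0 < p + k%:R by rewrite ltr_wpDr// ler0n.
have dfE k : (m + k.*2)%:R / 2 = p + k%:R :> R by rewrite /p -muln2 natrD natrM; field.
pose c := beta `^ (- p) * (x `^ (p - 1) * expR (- x / 2) / (2 `^ p * Gamma p)).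
have P20 : 2 `^ p != 0 :> R by rewrite gt_eqF ?powR_gt0.
have Gp0 : Gamma p != 0 by rewrite gt_eqF ?Gamma_gt0.
transitivity (c%:E * \sum_(k <oo) (((1 - beta^-1) * x / 2) ^+ k / k`!%:R)%:E)%E.
  rewrite nneseries_expR -EFinM; congr (_%:E).
  rewrite chi_square_pdfE -/p gamma_kernel_scale// /gamma_kernel x0 /c.
  have -> : - (1 / 2 * beta^-1 * x) = (- x / 2) + (1 - beta^-1) * x / 2 by field; exact/lt0r_neq0.
  have -> : beta `^ (- p) = beta^-1 * beta^-1 `^ (p - 1).
    by rewrite mulr_powRB1 ?ltW// powRVl ?ltW.
  by rewrite expRD; field; rewrite P20 Gp0 lt0r_neq0.
rewrite -nneseriesZl; last first.
  by move=> k _; rewrite lee_fin divr_ge0 ?exprn_ge0// mulr_ge0 ?invr_ge0// mulr_ge0// ltW.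
apply: eq_eseriesr => k _; rewrite -EFinM; congr (_%:E).
rewrite /nbinom_coef /chi_square_pdf x0 dfE /c.
rewrite (@powRD _ 2 p k%:R) ?(gt_eqF (ltr0n R 2)) ?implybT// powR_mulrn//.
have -> : p + k%:R - 1 = (p - 1) + k%:R by ring.
rewrite (@powRD _ x (p - 1) k%:R) ?(gt_eqF x0) ?implybT// powR_mulrn ?ltW//.
rewrite expr_div_n exprMn.
have F0 : k`!%:R != 0 :> R by rewrite pnatr_eq0 -lt0n fact_gt0.
have G0 : Gamma (p + k%:R) != 0 by exact/lt0r_neq0/Gamma_gt0.
have T0 : 2 ^+ k != 0 :> R by rewrite expf_neq0.
move: F0 G0 T0 P20 Gp0.
move: (beta `^ _) (x `^ _) (x ^+ k) (expR _) ((1 - beta^-1) ^+ k).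
move: (k`!%:R) (Gamma (p + k%:R)) (2 ^+ k) (2 `^ p) (Gamma p) => a1 a2 a3 a4 a5 a6 a7 a8 a9 a10.
by move=> F0 G0 T0 P20 Gp0; field; rewrite F0 G0 T0 P20 Gp0.
Qed.

Lemma chi_square_scale (R : realType) m (beta : R) (f : R -> \bar R) :
  (0 < m)%N -> 1 <= beta ->
  measurable_fun [set: R] f -> (forall x, 0 <= f x)%E ->
  (\int[lebesgue_measure]_x ((chi_square_pdf m x)%:E * f (beta * x)%R) =
   \sum_(k <oo) ((beta `^ (- (m%:R / 2)) * nbinom_coef (m%:R / 2) (1 - beta^-1) k)%:E *
     \int[lebesgue_measure]_x ((chi_square_pdf (m + k.*2) x)%:E * f x)))%E.
Proof.
move=> m0 b1 mf f0; have b0 : 0 < beta by exact: lt_le_trans b1.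
have bi0 : 0 < beta^-1 by rewrite invr_gt0.
have u0 : 0 <= 1 - beta^-1 by rewrite subr_ge0 invf_le1.
have w0 k : 0 <= beta `^ (- (m%:R / 2)) * nbinom_coef (m%:R / 2) (1 - beta^-1) k.
  by rewrite mulr_ge0 ?powR_ge0 ?nbinom_coef_ge0.
have mfb : measurable_fun [set: R] (fun x => f (beta * x)).
  by apply: measurableT_comp => //; exact: measurable_funM.
transitivity ((beta^-1)%:E * \int[lebesgue_measure]_x
    ((chi_square_pdf m (beta^-1 * x + 0))%:E * f (beta * (beta^-1 * x + 0))%R))%E.
  apply: (@ge0_integral_affine _ (fun x => (chi_square_pdf m x)%:E * f (beta * x)%R)%E) => //.
    exact: measurable_chi_square_pdf_mule.
  by move=> x; rewrite mule_ge0// lee_fin chi_square_pdf_ge0.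
rewrite -ge0_integralZl//=; last 3 first.
- apply: emeasurable_funM.
    apply/measurable_EFinP; apply: measurableT_comp; first exact: measurable_chi_square_pdf.
    exact: measurable_affine.
  apply: measurableT_comp => //; apply: measurable_funM => //; exact: measurable_affine.
- by move=> x _; rewrite mule_ge0// lee_fin chi_square_pdf_ge0.
- by rewrite lee_fin ltW.
pose F k x := ((beta `^ (- (m%:R / 2)) * nbinom_coef (m%:R / 2) (1 - beta^-1) k)%:E *
  ((chi_square_pdf (m + k.*2) x)%:E * f x))%E.
transitivity (\sum_(k <oo) \int[lebesgue_measure]_x F k x)%E; last first.
  apply: eq_eseriesr => k _; rewrite ge0_integralZl//=.
  - exact: measurable_chi_square_pdf_mule.
  - by move=> x _; rewrite mule_ge0// lee_fin chi_square_pdf_ge0.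
  - by rewrite lee_fin.
transitivity (\int[lebesgue_measure]_x \sum_(k <oo) F k x)%E; last first.
  rewrite integral_nneseries//; last 2 first.
- move=> k; apply: measurable_funeM; exact: measurable_chi_square_pdf_mule.
- by move=> k x _; rewrite !mule_ge0// ?lee_fin// chi_square_pdf_ge0.
apply: eq_integral => x _; rewrite addr0 mulVKf ?gt_eqF// muleA -EFinM chi_square_scale_pdf//.
rewrite -nneseriesZr//; last by move=> k; rewrite lee_fin mulr_ge0// chi_square_pdf_ge0.
by apply: eq_eseriesr => k _; rewrite /F muleA EFinM.
Qed.

(** The weights in [chi_square_scale] add up to 1, as f = 1 shows; this is the
    binomial series at u = 1 - 1 / beta. *)
Lemma nbinom_series (R : realType) m (u : R) : (0 < m)%N -> 0 <= u < 1 ->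
  (\sum_(k <oo) (nbinom_coef (m%:R / 2) u k)%:E = ((1 - u) `^ (- (m%:R / 2)))%:E)%E.
Proof.
move=> m0 /andP[u0 u1]; have v0 : 0 < 1 - u by rewrite subr_gt0.
have b1 : 1 <= (1 - u)^-1 by rewrite invf_ge1// gerBl.
have one k : (0 < k)%N ->
    (\int[lebesgue_measure]_x ((chi_square_pdf k x)%:E * cst 1 x) = 1 :> \bar R)%E.
  move=> k0; rewrite -[RHS](integral_chi_square_pdf R k0).
  by apply: eq_integral => x _; exact: mule1.
have H := chi_square_scale m0 b1 (measurable_cst 1%E) (fun=> lee01).
move: (etrans (esym (one m m0)) H); rewrite invrK subKr powRVl ?opprK; last exact: ltW.
set c := (1 - u) `^ (m%:R / 2).
have c0 : 0 < c by rewrite powR_gt0.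
rewrite (eq_eseriesr (g := fun k => c%:E * (nbinom_coef (m%:R / 2) u k)%:E)%E); last first.
  move=> k _; rewrite EFinM -[RHS]mule1; congr (_ * _)%E.
  by apply: one; rewrite addn_gt0 m0.
rewrite nneseriesZl; last by move=> k _; rewrite lee_fin nbinom_coef_ge0.
move=> /esym h; rewrite powRN -/c.
have -> : (c^-1)%:E = ((c^-1)%:E * 1)%E by rewrite mule1.
by rewrite -h muleA -EFinM mulVf ?mul1e// gt_eqF.
Qed.

(** * Independence of linear combinations *)

Definition independent_pair d (T : measurableType d) (R : realType)
    (P : probability T R) (X Y : T -> R) : Prop :=
  forall A B : set R, measurable A -> measurable B ->
    P (X @^-1` A `&` Y @^-1` B) = (P (X @^-1` A) * P (Y @^-1` B))%E.

Section independence.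
Context d (T : measurableType d) (R : realType) (P : probability T R).

Lemma integral_independent_pair (X Y : T -> R) (f : R * R -> \bar R) :
  measurable_fun [set: T] X -> measurable_fun [set: T] Y ->
  independent_pair P X Y ->
  measurable_fun [set: R * R] f -> (forall z, 0 <= f z)%E ->
  (\int[P]_w f (X w, Y w) = \int[P]_w \int[P]_v f (X w, Y v))%E.
Proof.
move=> mX mY indXY mf f0.
pose X' : {RV P >-> R} := HB.pack X (isMeasurableFun.Build _ _ _ _ _ mX).
pose Y' : {RV P >-> R} := HB.pack Y (isMeasurableFun.Build _ _ _ _ _ mY).
have mXY : measurable_fun [set: T] (fun w => (X w, Y w)) by exact: measurable_fun_pair.
transitivity (\int[pushforward P (fun w => (X w, Y w))]_z f z)%E.
  by rewrite ge0_integral_pushforward.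
transitivity (\int[distribution P X' \x distribution P Y']_z f z)%E.
  apply: eq_measure_integral => A mA _.
  by apply/esym/product_measure_unique => // B C mB mC; exact: indXY.
rewrite fubini_tonelli1//.
rewrite /fubini_F ge0_integral_distribution//=; last 2 first.
- exact: measurable_fun_fubini_tonelli_F.
- by move=> x; exact: integral_ge0.
apply: eq_integral => w _; rewrite ge0_integral_distribution//.
exact: measurableT_comp.
Qed.

(** Rectangles are stable under intersection and generate the product sigma-algebra. *)
Lemma independent_event_of_rectangles (X Y : T -> R) (G : set T) (E : set (R * R)) :
  measurable_fun [set: T] X -> measurable_fun [set: T] Y -> measurable G ->
  (forall A B : set R, measurable A -> measurable B ->
    P (X @^-1` A `&` Y @^-1` B `&` G) = (P G * P (X @^-1` A `&` Y @^-1` B))%E) ->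
  measurable E ->
  P ((fun w => (X w, Y w)) @^-1` E `&` G) = (P G * P ((fun w => (X w, Y w)) @^-1` E))%E.
Proof.
move=> mX mY mG rect mE.
have mXY : measurable_fun [set: T] (fun w => (X w, Y w)) by exact: measurable_fun_pair.
have PG : P G \is a fin_num by exact: fin_num_measure.
pose r : {nonneg R} := NngNum (fine_ge0 (measure_ge0 P G)).
have rE : (r%:num%:E = P G)%E by rewrite /= fineK.
rewrite -rE.
pose C : set (set (R * R)) := [set A `*` B | A in measurable & B in measurable].
apply: (measure_unique C (fun=> setT) _ _ _ _
  (pushforward (mrestr P mG) (fun w => (X w, Y w)))
  (mscale r (pushforward P (fun w => (X w, Y w))))) => //.
- exact: measurable_prod_measurableType.
- move=> _ _ [A1 mA1 [A2 mA2 <-]] [B1 mB1 [B2 mB2 <-]].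
  exists (A1 `&` B1); first exact: measurableI.
  by exists (A2 `&` B2); [exact: measurableI|rewrite setXI].
- by move=> _; exists setT => //; exists setT => //; rewrite setXTT.
- by apply/seteqP; split => // z _; exists 0%N.
- move=> _ [A mA [B mB <-]].
  change (P (X @^-1` A `&` Y @^-1` B `&` G) =
    r%:num%:E * P (X @^-1` A `&` Y @^-1` B))%E.
  by rewrite rE; exact: rect.
- by move=> _; rewrite /= /pushforward /mrestr preimage_setT setTI ltey_eq PG.
Qed.

(** Induction on s. For i :: s the induction hypothesis, with i added to J, shows that
    the event given by J is independent of the rectangles in the plane of the pair
    (X i, sum over s), hence of every event that depends on this pair. *)
Lemma independent_sum (I : finType) (X : I -> {RV P >-> R}) (b : I -> R) (s : seq I)
    (J : {set I}) (S : I -> set R) (B : set R) :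
  mutually_independent X -> uniq s -> (forall i, i \in s -> i \notin J) ->
  (forall i, i \in J -> measurable (S i)) -> measurable B ->
  P ((fun w => \sum_(i <- s) b i * X i w) @^-1` B `&`
     \bigcap_(i in [set` J]) (X i @^-1` S i)) =
  (P ((fun w => \sum_(i <- s) b i * X i w)%R @^-1` B) *
   \prod_(i in J) P (X i @^-1` S i))%E.
Proof.
move=> indX; elim: s J S B => [|i s IH] J S B.
  move=> _ _ mS mB; rewrite -indX//.
  have [B0|B0] := pselect (B 0).
    rewrite (_ : _ @^-1` B = setT) ?probability_setT ?mul1e ?setTI//.
    by apply/seteqP; split => // w _ /=; rewrite big_nil.
  rewrite (_ : _ @^-1` B = set0) ?set0I ?measure0 ?mul0e//.
  by apply/seteqP; split => // w /=; rewrite big_nil.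
move=> /= /andP[nis us] sJ mS mB.
pose Y w := \sum_(j <- s) b j * X j w.
have mY : measurable_fun [set: T] Y.
  by apply: measurable_sum => j; exact: measurable_funM.
have mX j : measurable_fun [set: T] (X j) by [].
have iJ : i \notin J by apply: sJ; rewrite mem_head.
have sJ' j : j \in s -> j \notin J by move=> js; apply: sJ; rewrite in_cons js orbT.
set G := \bigcap_(i in _) _.
have mG : measurable G.
  apply: fin_bigcap_measurable; first exact: finite_finset.
  move=> j jJ; rewrite -[X in measurable X]setTI; apply: mX => //; exact: mS.
have PGE : P G = (\prod_(i in J) P (X i @^-1` S i))%E by exact: indX.
rewrite -PGE muleC.
pose E : set (R * R) := (fun z => b i * z.1 + z.2) @^-1` B.
have mE : measurable E.
  rewrite -[E]setTI; have : measurable_fun [set: R * R] (fun z => b i * z.1 + z.2).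
    by apply: measurable_funD => //; exact: measurable_funM.
  exact.
have -> : (fun w => \sum_(j <- i :: s) b j * X j w) @^-1` B = (fun w => (X i w, Y w)) @^-1` E.
  by apply/seteqP; split => w /=; rewrite /E/= big_cons.
apply: independent_event_of_rectangles => // A C mA mC.
have neq_i j : j \in J -> (j == i) = false by apply: contraTF => /eqP ->.
pose S' j := if j == i then A else S j.
have IHJ : P (Y @^-1` C `&` \bigcap_(j in [set` i |: J]) (X j @^-1` S' j)) =
    (P (Y @^-1` C) * \prod_(j in i |: J) P (X j @^-1` S' j))%E.
  apply: IH => //.
    move=> j js; rewrite in_setU1 negb_or sJ'// andbT.
    by apply: contraNneq nis => <-.
  move=> j; rewrite in_setU1 /S'; case: eqP => //= _; exact: mS.
have IH1 : P (Y @^-1` C `&` \bigcap_(j in [set` [set i]%SET]) (X j @^-1` A)) =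
    (P (Y @^-1` C) * \prod_(j in [set i]%SET) P (X j @^-1` A))%E.
  by apply: IH => // j js; rewrite finset.in_set1; apply: contraNneq nis => <-.
have -> : X i @^-1` A `&` Y @^-1` C `&` G =
    Y @^-1` C `&` \bigcap_(j in [set` i |: J]) (X j @^-1` S' j).
  apply/seteqP; split => w /=.
    move=> [[Aw Cw] Gw]; split => // j /=; rewrite in_setU1 /S'.
    by case: eqP => [-> //|_ /= jJ]; exact: Gw.
  move=> [Cw Gw]; split; [split => //|].
    by have := Gw i; rewrite /= in_setU1 /S' eqxx; apply.
  by move=> j /= jJ; have := Gw j; rewrite /= in_setU1 /S' neq_i//; apply; rewrite jJ orbT.
rewrite IHJ big_setU1//= {1}/S' eqxx.
have -> : (\prod_(j in J) P (X j @^-1` S' j) = P G)%E.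
  by rewrite PGE; apply: eq_bigr => j jJ; rewrite /S' neq_i.
have -> : X i @^-1` A `&` Y @^-1` C =
    Y @^-1` C `&` \bigcap_(j in [set` [set i]%SET]) (X j @^-1` A).
  apply/seteqP; split => w /=.
    by move=> [Aw Cw]; split => // j /=; rewrite finset.in_set1 => /eqP ->.
  by move=> [Cw Aw]; split => //; apply: Aw; rewrite /= finset.in_set1.
by rewrite IH1 big_set1 [RHS]muleC muleA.
Qed.

Lemma independent_pair_sum (I : finType) (X : I -> {RV P >-> R}) (b : I -> R)
    (s : seq I) (i : I) :
  mutually_independent X -> uniq s -> i \notin s ->
  independent_pair P (X i) (fun w => \sum_(j <- s) b j * X j w).
Proof.
move=> indX us nis A B mA mB.
have := @independent_sum I X b s [set i]%SET (fun=> A) B indX us.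
rewrite big_set1 muleC setIC.
have -> : \bigcap_(j in [set` [set i]%SET]) (X j @^-1` A) = X i @^-1` A.
  apply/seteqP; split => w /=; first by apply; rewrite /= finset.in_set1.
  by move=> Aw j /=; rewrite finset.in_set1 => /eqP ->.
by apply => // j js; rewrite finset.in_set1; apply: contraNneq nis => <-.
Qed.

End independence.

(** * Mixtures of chi-square laws *)

(** The law of Y is the mixture of the chi-square laws with k + 2 l degrees of freedom
    with weights c l. Testing against all nonnegative f, possibly infinite, lets the
    property be applied to functions that are themselves integrals. *)
Definition chi_square_mixture d (T : measurableType d) (R : realType)
    (P : probability T R) (Y : T -> R) (c : nat -> R) (k : nat) : Prop :=
  forall f : R -> \bar R, measurable_fun [set: R] f -> (forall x, 0 <= f x)%E ->
  (\int[P]_w f (Y w) =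
   \sum_(l <oo) ((c l)%:E *
     \int[lebesgue_measure]_x ((chi_square_pdf (k + l.*2) x)%:E * f x)))%E.

Definition scaled_weight (R : realType) (b : R) (m k : nat) : R :=
  b `^ (- (m%:R / 2)) * nbinom_coef (m%:R / 2) (1 - b^-1) k.

Lemma scaled_weight_ge0 (R : realType) (b : R) m k : 1 <= b -> 0 <= scaled_weight b m k.
Proof.
move=> b1; rewrite mulr_ge0 ?powR_ge0// nbinom_coef_ge0// subr_ge0 invf_le1//.
exact: lt_le_trans b1.
Qed.

Fixpoint sum_weights (R : realType) (I : Type) (b : I -> R) (m : I -> nat)
    (s : seq I) : nat -> R :=
  if s is i :: s' then cauchy_prod (scaled_weight (b i) (m i)) (sum_weights b m s')
  else fun l => (l == 0%N)%:R.

Lemma sum_weights_ge0 (R : realType) (I : Type) (b : I -> R) (m : I -> nat) s l :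
  (forall i, 1 <= b i) -> 0 <= sum_weights b m s l.
Proof.
move=> b1; elim: s l => [|i s IH] l /=; first exact: ler0n.
by apply: cauchy_prod_ge0 => // k; exact: scaled_weight_ge0.
Qed.

Lemma sum_weights_series (R : realType) (I : Type) (b : I -> R) (m : I -> nat)
    (s : seq I) (z : R) :
  (forall i, 1 <= b i) -> (forall i, (0 < m i)%N) -> 0 <= z <= 1 ->
  (\sum_(l <oo) (sum_weights b m s l * z ^+ l)%:E =
   (\prod_(i <- s) (b i `^ (- ((m i)%:R / 2)) *
      (1 - (1 - (b i)^-1) * z) `^ (- ((m i)%:R / 2))))%:E)%E.
Proof.
move=> b1 m0 /andP[z0 z1].
have zl l : (0 <= (z ^+ l)%:E)%E by rewrite lee_fin exprn_ge0.
elim: s => [|i s IH] /=.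
  rewrite big_nil (nneseries_split 0 1)//=; last first.
    by move=> k _; rewrite lee_fin mulr_ge0// exprn_ge0.
  rewrite big_nat1 eqxx mulr1 eseries0 ?adde0//.
  by move=> [|k]//= _ _; rewrite mul0r.
have w0 k : 0 <= scaled_weight (b i) (m i) k by exact: scaled_weight_ge0.
have s0 k : 0 <= sum_weights b m s k by exact: sum_weights_ge0.
rewrite big_cons EFinM -IH.
under eq_eseriesr do rewrite EFinM.
rewrite -nneseries_cauchy_prod//.
have b0 : 0 < b i by exact: lt_le_trans (b1 i).
have u0 : 0 <= 1 - (b i)^-1 by rewrite subr_ge0 invf_le1.
have uz : 0 <= (1 - (b i)^-1) * z < 1.
  rewrite mulr_ge0//=; have : 0 < (b i)^-1 by rewrite invr_gt0.
  nra.
rewrite EFinM -nbinom_series// -nneseriesZl; last first.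
  by move=> k _; rewrite lee_fin nbinom_coef_ge0//; case/andP: uz.
rewrite -nneseriesZr; last 2 first.
- move=> k; rewrite mule_ge0// lee_fin ?powR_ge0// nbinom_coef_ge0//; by case/andP: uz.
- by apply: nneseries_ge0 => l _ _; rewrite lee_fin mulr_ge0// exprn_ge0.
apply: eq_eseriesr => j _.
rewrite -nneseriesZl; last by move=> l _; rewrite -EFinM lee_fin mulr_ge0// exprn_ge0.
rewrite -EFinM -nneseriesZl; last by move=> l _; rewrite lee_fin mulr_ge0// exprn_ge0.
apply: eq_eseriesr => l _; rewrite -!EFinM; congr (_%:E).
by rewrite /scaled_weight /nbinom_coef exprD exprMn; ring.
Qed.

Section mixture.
Context d (T : measurableType d) (R : realType) (P : probability T R).

Lemma chi_square_expectation k (X : {RV P >-> R}) (f : R -> \bar R) :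
  is_chi_square k X -> measurable_fun [set: R] f -> (forall x, 0 <= f x)%E ->
  (\int[P]_w f (X w) = \int[lebesgue_measure]_x ((chi_square_pdf k x)%:E * f x))%E.
Proof.
move=> Xk mf f0.
have mX0 : measurable_fun [set: T] X by [].
have mX : measurable_fun [set: T] (X : T -> measurableTypeR R) by exact: mX0.
pose X' : {mfun T >-> measurableTypeR R} :=
  HB.pack (X : T -> measurableTypeR R) (isMeasurableFun.Build _ _ _ _ _ mX).
transitivity (\int[distribution P X']_x f x)%E.
  by rewrite ge0_integral_distribution.
apply: ge0_integral_density => //.
- exact: measurable_chi_square_pdf.
- by move=> x; exact: chi_square_pdf_ge0.
Qed.

Lemma chi_square_mixture_scale m (b : R) (X : {RV P >-> R}) :
  is_chi_square m X -> (0 < m)%N -> 1 <= b ->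
  chi_square_mixture P (fun w => b * X w) (scaled_weight b m) m.
Proof.
move=> Xm m0 b1 f mf f0.
rewrite -chi_square_scale//.
rewrite (@chi_square_expectation m X (fun x => f (b * x)))//.
by apply: measurableT_comp => //; exact: measurable_funM.
Qed.

(** By independence the expectation is an iterated one; the two mixture properties
    turn it into a double series of convolution integrals, and the (l, n) integral
    depends on l + n only. *)
Lemma chi_square_mixture_add (X Y : T -> R) (a b : nat -> R) j k :
  measurable_fun [set: T] X -> measurable_fun [set: T] Y ->
  independent_pair P X Y -> (0 < j)%N -> (0 < k)%N ->
  (forall l, 0 <= a l) -> (forall l, 0 <= b l) ->
  chi_square_mixture P X a j -> chi_square_mixture P Y b k ->
  chi_square_mixture P (fun w => X w + Y w) (cauchy_prod a b) (j + k).
Proof.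
move=> mX mY indXY j0 k0 a0 b0 mixX mixY f mf f0.
have mfD : measurable_fun [set: R * R] (fun z => f (z.1 + z.2)).
  by apply: measurableT_comp => //; exact: measurable_funD.
have mfx x : measurable_fun [set: R] (fun y => f (x + y)).
  by apply: measurableT_comp => //; exact: measurable_funD.
rewrite (integral_independent_pair (f := fun z => f (z.1 + z.2)))//=.
pose I (l : nat) (x : R) := (\int[lebesgue_measure]_y
  ((chi_square_pdf (k + l.*2) y)%:E * f (x + y)%R))%E.
pose g (x : R) := (\sum_(l <oo) ((b l)%:E * I l x))%E.
have I0 l x : (0 <= I l x)%E.
  by apply: integral_ge0 => y _; rewrite mule_ge0// lee_fin chi_square_pdf_ge0.
have mI l : measurable_fun [set: R] (I l).
  apply: (@measurable_fun_fubini_tonelli_F _ _ _ _ _ lebesgue_measure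
      (fun z : R * R => (chi_square_pdf (k + l.*2) z.2)%:E * f (z.1 + z.2)%R)%E).
    apply: emeasurable_funM => //.
    apply/measurable_EFinP; apply: measurableT_comp => //.
    exact: measurable_chi_square_pdf.
  by move=> z; rewrite mule_ge0// lee_fin chi_square_pdf_ge0.
have g0 x : (0 <= g x)%E.
  by apply: nneseries_ge0 => l _ _; rewrite mule_ge0// lee_fin.
have mg : measurable_fun [set: R] g.
  apply: ge0_emeasurable_sum => l; first by move=> x _ _; rewrite mule_ge0// lee_fin.
  by move=> _; exact: measurable_funeM.
transitivity (\int[P]_w g (X w))%E.
  by apply: eq_integral => w _; rewrite (mixY (fun y => f (X w + y))).
rewrite (mixX g)//.
pose h (n : nat) := (\int[lebesgue_measure]_x ((chi_square_pdf (j + k + n.*2) x)%:E * f x))%E.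
transitivity (\sum_(l <oo) ((a l)%:E * \sum_(n <oo) ((b n)%:E * h (l + n)%N)))%E; last first.
  apply: nneseries_cauchy_prod => // n.
  by apply: integral_ge0 => x _; rewrite mule_ge0// lee_fin chi_square_pdf_ge0.
apply: eq_eseriesr => l _; congr (_ * _)%E.
pose F n x := ((b n)%:E * ((chi_square_pdf (j + l.*2) x)%:E * I n x))%E.
transitivity (\int[lebesgue_measure]_x \sum_(n <oo) F n x)%E.
  apply: eq_integral => x _.
  rewrite /g -nneseriesZl; last by move=> n _; rewrite mule_ge0// lee_fin.
  by apply: eq_eseriesr => n _; rewrite /F muleCA.
rewrite integral_nneseries//; last 2 first.
- by move=> n; apply: measurable_funeM; exact: measurable_chi_square_pdf_mule.
- by move=> n x _; rewrite !mule_ge0// ?lee_fin// chi_square_pdf_ge0.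
apply: eq_eseriesr => n _; rewrite ge0_integralZl//=; last 3 first.
- exact: measurable_chi_square_pdf_mule.
- by move=> x _; rewrite mule_ge0// lee_fin chi_square_pdf_ge0.
- by rewrite lee_fin.
congr (_ * _)%E; rewrite /h doubleD addnACA.
by apply: chi_square_convolution => //; rewrite addn_gt0 ?j0 ?k0.
Qed.

Lemma chi_square_mixture_sum (I : finType) (X : I -> {RV P >-> R}) (b : I -> R)
    (m : I -> nat) (s : seq I) :
  mutually_independent X -> (forall i, i \in s -> is_chi_square (m i) (X i)) ->
  (forall i, (0 < m i)%N) -> (forall i, 1 <= b i) -> uniq s -> s != [::] ->
  chi_square_mixture P (fun w => \sum_(i <- s) b i * X i w)
    (sum_weights b m s) (\sum_(i <- s) m i).
Proof.
move=> indX Xm m0 b1.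
elim: s Xm => // i s IH Xm /= /andP[nis us] _.
have mixi : chi_square_mixture P (fun w => b i * X i w) (scaled_weight (b i) (m i)) (m i).
  by apply: chi_square_mixture_scale => //; apply: Xm; rewrite mem_head.
have [->|s0] := eqVneq s [::].
  rewrite /= cauchy_prod1r big_seq1 => f mf f0.
  by rewrite -mixi//; apply: eq_integral => w _; rewrite big_seq1.
pose Y w := \sum_(j <- s) b j * X j w.
have mY : measurable_fun [set: T] Y.
  by apply: measurable_sum => j; exact: measurable_funM.
have indY := @independent_pair_sum _ _ _ P I X b s i indX us nis.
have df0 : (0 < \sum_(j <- s) m j)%N.
  by case: s s0 {IH Xm nis us Y mY indY} => // j s _; rewrite big_cons addn_gt0 m0.
have mixY : chi_square_mixture P Y (sum_weights b m s) (\sum_(j <- s) m j).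
  by apply: IH => // j js; apply: Xm; rewrite in_cons js orbT.
rewrite big_cons => f mf f0.
rewrite -(@chi_square_mixture_add (fun w => b i * X i w) Y _ _ _ _ _ mY _ _ _ _ _ mixi mixY)//.
- by apply: eq_integral => w _; rewrite big_cons.
- exact: measurable_funM.
- move=> A B mA mB; have := indY (( *%R (b i)) @^-1` A) B; apply => //.
  have mb : measurable_fun [set: R] ( *%R (b i)) by exact: measurable_funM.
  by rewrite -[X in measurable X]setTI; exact: mb.
- by move=> l; exact: scaled_weight_ge0.
- by move=> l; exact: sum_weights_ge0.
Qed.

End mixture.

(** * The chi-square distribution function *)

Definition chi_square_cdf (R : realType) (k : nat) (x : R) : \bar R :=
  (\int[lebesgue_measure]_q ((chi_square_pdf k q)%:E * ((q <= x)%R%:R)%:E))%E.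

Lemma measurable_le_indic (R : realType) (x : R) :
  measurable_fun [set: R] (fun q : R => (((q <= x)%R%:R : R)%:E)).
Proof.
apply/measurable_EFinP; rewrite (_ : (fun _ => _) = fun q : R => if q <= x then 1 else 0).
  by apply: measurable_fun_ifT => //; exact: measurable_fun_ler.
by apply/funext => q; case: ifP.
Qed.

Lemma chi_square_cdf_ge0 (R : realType) k (x : R) : (0 <= chi_square_cdf k x)%E.
Proof.
by apply: integral_ge0 => q _; rewrite mule_ge0// lee_fin ?chi_square_pdf_ge0.
Qed.

Lemma measurable_chi_square_cdf (R : realType) k :
  measurable_fun [set: R] (chi_square_cdf k : R -> \bar R).
Proof.
apply: (@measurable_fun_fubini_tonelli_F _ _ _ _ _ lebesgue_measure
  (fun z : R * R => (chi_square_pdf k z.2)%:E * ((z.2 <= z.1)%R%:R)%:E)%E).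
  apply: emeasurable_funM.
    apply/measurable_EFinP; apply: measurableT_comp => //.
    exact: measurable_chi_square_pdf.
  apply/measurable_EFinP.
  rewrite (_ : (fun _ => _) = fun z : R * R => if z.2 <= z.1 then 1 else 0).
    by apply: measurable_fun_ifT => //; exact: measurable_fun_ler.
  by apply/funext => z; case: ifP.
by move=> z; rewrite mule_ge0// lee_fin ?chi_square_pdf_ge0.
Qed.

(** For two degrees of freedom the density is exponential, so that shifting it by t
    multiplies it by e^(-t / 2). *)
Lemma chi_square2_tail (R : realType) (t : R) : 0 <= t ->
  (\int[lebesgue_measure]_r ((chi_square_pdf 2 r)%:E * ((t < r)%R%:R)%:E) =
   (expR (- (t / 2)))%:E)%E.
Proof.
move=> t0.
have mi : measurable_fun [set: R] (fun r : R => (((t < r)%R%:R : R)%:E)).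
  apply/measurable_EFinP; rewrite (_ : (fun _ => _) = fun q : R => if t < q then 1 else 0).
    by apply: measurable_fun_ifT => //; exact: measurable_fun_ltr.
  by apply/funext => q; case: ifP.
transitivity (1%:E * \int[lebesgue_measure]_r ((chi_square_pdf 2 (1 * r + t))%:E *
    ((t < 1 * r + t)%R%:R)%:E))%E.
  apply: (@ge0_integral_affine _ (fun r => (chi_square_pdf 2 r)%:E * ((t < r)%R%:R)%:E)%E) => //.
    exact: measurable_chi_square_pdf_mule.
  by move=> r; rewrite mule_ge0// lee_fin ?chi_square_pdf_ge0.
rewrite mul1e.
transitivity (\int[lebesgue_measure]_r ((expR (- (t / 2)))%:E * (chi_square_pdf 2 r)%:E))%E.
  apply: eq_integral => r _; rewrite mul1r ltrDr -!EFinM; congr (_%:E).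
  rewrite /chi_square_pdf; case: (ltP 0 r) => r0; last by rewrite !mulr0.
  rewrite ltr_wpDr// divff// subrr !powRr0 mulr1.
  have -> : - (r + t) / 2 = - (t / 2) + - r / 2 by field.
  by rewrite expRD; ring.
rewrite ge0_integralZl//=.
- by rewrite integral_chi_square_pdf// mule1.
- by apply/measurable_EFinP; exact: measurable_chi_square_pdf.
- by move=> r _; rewrite lee_fin chi_square_pdf_ge0.
Qed.

(** The left-hand side is the probability that X <= x < X + Y, for X chi-square with k
    degrees of freedom and Y independent with two. *)
Lemma chi_square_overshoot (R : realType) k (x : R) : (0 < k)%N -> 0 < x ->
  (\int[lebesgue_measure]_q ((chi_square_pdf k q)%:E *
      ((q <= x)%R%:R * expR (- ((x - q) / 2)))%:E) =
   (x `^ (k%:R / 2) * expR (- x / 2) / (2 `^ (k%:R / 2) * Gamma (k%:R / 2 + 1)))%:E)%E.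
Proof.
move=> k0 x0; set p := k%:R / 2; have p0 : 0 < p by rewrite divr_gt0// ltr0n.
pose c := expR (- x / 2) / (2 `^ p * Gamma p).
have c0 : 0 <= c by rewrite divr_ge0 ?expR_ge0// mulr_ge0 ?powR_ge0 ?Gamma_ge0.
transitivity (\int[lebesgue_measure]_(q in `]0%R, x]) (c%:E * (q `^ (p - 1))%:E))%E.
  rewrite [RHS]integral_mkcond; apply: eq_integral => q _.
  rewrite patchE mem_setE in_itv/= /chi_square_pdf -/p.
  case: (ltP 0 q) => q0 /=; last by rewrite mul0e.
  case: (q <= x); last by rewrite mul0r mule0.
  rewrite mul1r -!EFinM; congr (_%:E); rewrite /c.
  have -> : - x / 2 = - q / 2 + - ((x - q) / 2) by field.
  by rewrite expRD; field; rewrite !gt_eqF ?powR_gt0 ?Gamma_gt0.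
rewrite ge0_integralZl//=; last 2 first.
- by apply/measurable_EFinP; apply: measurable_funTS; exact: measurable_powR.
- by move=> q _; rewrite lee_fin powR_ge0.
rewrite integral_powR_oc// -EFinM GammaS//; congr (_%:E); rewrite /c.
by field; rewrite !gt_eqF ?powR_gt0 ?Gamma_gt0.
Qed.

(** With X and Y as in [chi_square_overshoot], X + Y has k + 2 degrees of freedom and
    the event X <= x is the disjoint union of X + Y <= x and X <= x < X + Y. *)
Lemma chi_square_cdf_rec (R : realType) k (x : R) : (0 < k)%N -> 0 < x ->
  (chi_square_cdf k x = chi_square_cdf (k + 2) x +
   (x `^ (k%:R / 2) * expR (- x / 2) / (2 `^ (k%:R / 2) * Gamma (k%:R / 2 + 1)))%:E)%E.
Proof.
move=> k0 x0; rewrite -chi_square_overshoot// /chi_square_cdf.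
have mi := @measurable_le_indic R x.
transitivity (\int[lebesgue_measure]_q ((chi_square_pdf k q)%:E *
    \int[lebesgue_measure]_r ((chi_square_pdf 2 r)%:E * ((q + r <= x)%R%:R)%:E)) +
  \int[lebesgue_measure]_q ((chi_square_pdf k q)%:E *
    ((q <= x)%R%:R * expR (- ((x - q) / 2)))%:E))%E; last first.
  congr (_ + _)%E.
  by apply: (@chi_square_convolution R k 2 (fun q => ((q <= x)%R%:R)%:E)).
have mD q : measurable_fun [set: R] (fun r : R => ((q + r <= x)%R%:R : R)%:E).
  by apply: (measurableT_comp mi); exact: measurable_funD.
have m2 q : measurable_fun [set: R]
    (fun r : R => (chi_square_pdf 2 r)%:E * ((q + r <= x)%R%:R)%:E)%E.
  exact: measurable_chi_square_pdf_mule.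
have p0 l q (b : R) : 0 <= b -> (0 <= (chi_square_pdf l q)%:E * b%:E)%E.
  by move=> b0; rewrite mule_ge0// lee_fin chi_square_pdf_ge0.
rewrite -ge0_integralD//=; last 4 first.
- move=> q _; rewrite mule_ge0 ?lee_fin ?chi_square_pdf_ge0//.
  by apply: integral_ge0 => r _; exact: p0.
- apply: measurable_chi_square_pdf_mule.
  apply: (@measurable_fun_fubini_tonelli_F _ _ _ _ _ lebesgue_measure
    (fun z : R * R => (chi_square_pdf 2 z.2)%:E * ((z.1 + z.2 <= x)%R%:R)%:E)%E).
    apply: emeasurable_funM.
      apply/measurable_EFinP; apply: measurableT_comp => //.
      exact: measurable_chi_square_pdf.
    by apply: (measurableT_comp mi); exact: measurable_funD.
  by move=> z; exact: p0.
- by move=> q _; apply: p0; rewrite mulr_ge0// expR_ge0.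
- apply: measurable_chi_square_pdf_mule; apply/measurable_EFinP.
  apply: measurable_funM; first exact/measurable_EFinP.
  apply: measurableT_comp => //; apply: measurableT_comp => //.
  by apply: measurable_funM => //; exact: measurable_funB.
apply: eq_integral => q _; rewrite -muleDr//; last 1 first.
- apply: ge0_adde_def; rewrite inE ?lee_fin ?mulr_ge0 ?expR_ge0//.
  by apply: integral_ge0 => r _; exact: p0.
congr (_ * _)%E.
case: (leP q x) => qx; last first.
  rewrite mul0r adde0 integral0_eq// => r _.
  rewrite /chi_square_pdf; case: ifP => r0; last by rewrite mul0e.
  by rewrite leNgt (lt_trans qx) ?ltrDl// mule0.
rewrite mul1r -chi_square2_tail ?subr_ge0// -ge0_integralD//=; last 4 first.
- by move=> r _; exact: p0.
- exact: m2.
- by move=> r _; exact: p0.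
- apply: measurable_chi_square_pdf_mule.
  rewrite (_ : (fun _ => _) = fun r : R => (1 - ((q + r <= x)%R%:R : R))%:E).
    apply/measurable_EFinP; apply: measurable_funB => //; apply/measurable_EFinP; exact: mD.
  by apply/funext => r; rewrite ltrBlDl ltNge; case: (_ <= _); rewrite ?subrr ?subr0.
rewrite -(@integral_chi_square_pdf R 2)//; apply: eq_integral => r _.
by rewrite -!EFinM -EFinD -mulrDr ltrBlDl ltNge; case: (_ <= _); rewrite /= ?addr0 ?add0r mulr1.
Qed.

(** Chernoff bound: the indicator of q <= x is at most e^(t (x - q)). *)
Lemma chi_square_cdf_le (R : realType) k (t x : R) : (0 < k)%N -> 0 <= t ->
  (chi_square_cdf k x <= (expR (t * x) * (1 + 2 * t) `^ (- (k%:R / 2)))%:E)%E.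
Proof.
move=> k0 t0; rewrite EFinM -chi_square_laplace//; last lra.
have me : measurable_fun [set: R] (fun q => (expR (- (t * q)))%:E).
  apply/measurable_EFinP; apply: measurableT_comp => //.
  by apply: measurableT_comp => //; exact: measurable_funM.
rewrite -ge0_integralZl//=; last 2 first.
- exact: (measurable_chi_square_pdf_mule k me).
- by move=> q _; rewrite mule_ge0// lee_fin ?chi_square_pdf_ge0 ?expR_ge0.
apply: ge0_le_integral => //=.
- by move=> q _; rewrite mule_ge0// lee_fin ?chi_square_pdf_ge0.
- exact: (measurable_chi_square_pdf_mule k (measurable_le_indic x)).
- exact: measurable_funeM (measurable_chi_square_pdf_mule k me).
move=> q _; rewrite muleCA lee_wpmul2l ?lee_fin ?chi_square_pdf_ge0//.
rewrite -expRD; case: (leP q x) => qx; last by rewrite expR_ge0.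
by rewrite -expR0 ler_expR -mulrBr mulr_ge0// subr_ge0.
Qed.

(** * The distribution of a ratio of chi-square variables *)

(** For X chi-square with k degrees of freedom, V with nu and X, V independent, the
    probability that X <= z V. *)
Definition chi_square_ratio_cdf (R : realType) (nu : nat) (z : R) (k : nat) : \bar R :=
  (\int[lebesgue_measure]_v ((chi_square_pdf nu v)%:E * chi_square_cdf k (z * v)%R))%E.

Definition ratio_term (R : realType) (nu : nat) (z : R) (k : nat) : R :=
  Gamma ((nu%:R + k%:R) / 2) / (Gamma (k%:R / 2 + 1) * Gamma (nu%:R / 2)) *
  (z `^ (k%:R / 2) / (1 + z) `^ ((nu%:R + k%:R) / 2)).

Lemma ratio_term_ge0 (R : realType) nu (z : R) k : 0 <= ratio_term nu z k.
Proof. by rewrite mulr_ge0 ?divr_ge0 ?mulr_ge0 ?Gamma_ge0 ?powR_ge0. Qed.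

(** [chi_square_cdf_rec] at x = z v, integrated against the density of V; the
    correction becomes a Gamma integral with rate (1 + z) / 2. *)
Lemma chi_square_ratio_cdf_rec (R : realType) (nu : nat) (z : R) k :
  (0 < nu)%N -> (0 < k)%N -> 0 < z ->
  (chi_square_ratio_cdf nu z k =
   chi_square_ratio_cdf nu z (k + 2) + (ratio_term nu z k)%:E)%E.
Proof.
move=> nu0 k0 z0; pose p : R := k%:R / 2; pose q : R := nu%:R / 2.
have p0 : 0 < p by rewrite divr_gt0// ltr0n.
have q0 : 0 < q by rewrite divr_gt0// ltr0n.
have [c cE] : exists c, c = z `^ p / (2 `^ p * Gamma (p + 1) * (2 `^ q * Gamma q)) by eexists.
have c0 : 0 <= c by rewrite cE divr_ge0 ?mulr_ge0 ?powR_ge0 ?Gamma_ge0.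
have mz l : measurable_fun [set: R] (fun v => chi_square_cdf l (z * v)%R).
  by apply: (measurableT_comp (@measurable_chi_square_cdf R l)); exact: measurable_funM.
have -> : (ratio_term nu z k)%:E =
    (\int[lebesgue_measure]_v (c%:E * (gamma_kernel (p + q) ((1 + z) / 2) v)%:E))%E.
  rewrite ge0_integralZl//=; last 2 first.
  - by apply/measurable_EFinP; exact: measurable_gamma_kernel.
  - by move=> v _; rewrite lee_fin gamma_kernel_ge0.
  rewrite integral_gamma_kernel; [|exact: addr_gt0|by rewrite divr_gt0// addr_gt0].
  rewrite -EFinM; congr (_%:E); rewrite /ratio_term cE -/p -/q.
  have -> : (nu%:R + k%:R) / 2 = p + q by rewrite /p /q; field.
  rewrite [((1 + z) / 2) `^ _]powRM ?invr_ge0 ?addr_ge0 ?(ltW z0)//.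
  rewrite powRVl// opprK powRN (@powRD _ 2 p q); last by rewrite (gt_eqF (ltr0n R 2)) implybT.
  have P1 : (1 + z) `^ (p + q) != 0 by rewrite gt_eqF ?powR_gt0 ?addr_gt0.
  have P2 : 2 `^ p != 0 :> R by rewrite gt_eqF ?powR_gt0.
  have P3 : 2 `^ q != 0 :> R by rewrite gt_eqF ?powR_gt0.
  have G1 : Gamma (p + 1) != 0 by rewrite gt_eqF ?Gamma_gt0 ?addr_gt0.
  have G2 : Gamma q != 0 by rewrite gt_eqF ?Gamma_gt0.
  move: P1 P2 P3 G1 G2.
  move: (_ `^ (p + q)) (2 `^ p) (2 `^ q) (Gamma (p + 1)) (Gamma q) (z `^ p) (Gamma (p + q)).
  by move=> a1 a2 a3 a4 a5 a6 a7 P1 P2 P3 G1 G2; field; rewrite P1 P2 P3 G1 G2.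
rewrite /chi_square_ratio_cdf -ge0_integralD//=; last 4 first.
- by move=> v _; rewrite mule_ge0// ?chi_square_cdf_ge0// lee_fin chi_square_pdf_ge0.
- exact: measurable_chi_square_pdf_mule.
- by move=> v _; rewrite mule_ge0// lee_fin gamma_kernel_ge0.
- by apply: measurable_funeM; apply/measurable_EFinP; exact: measurable_gamma_kernel.
apply: eq_integral => v _; have [v0|v0] := ltP 0 v; last first.
  have -> : chi_square_pdf nu v = 0 by rewrite /chi_square_pdf ltNge v0.
  have -> : gamma_kernel (p + q) ((1 + z) / 2) v = 0 by rewrite /gamma_kernel ltNge v0.
  have e0 (x1 x2 x3 : \bar R) : (0%:E * x1 = 0%:E * x2 + x3 * 0%:E)%E.
    by rewrite !mul0e mule0 adde0.
  exact: e0.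
rewrite chi_square_cdf_rec ?mulr_gt0// muleDr//; last first.
  apply: ge0_adde_def; rewrite inE ?chi_square_cdf_ge0// lee_fin.
  by rewrite divr_ge0 ?mulr_ge0 ?expR_ge0 ?powR_ge0 ?Gamma_ge0.
congr (_ + _)%E; rewrite -!EFinM; congr (_%:E).
rewrite /chi_square_pdf /gamma_kernel v0 -/p -/q cE powRM ?(ltW z0) ?(ltW v0)//.
have -> : p + q - 1 = p + (q - 1) by ring.
rewrite (@powRD _ v p (q - 1)); last by rewrite (gt_eqF v0) implybT.
have -> : - ((1 + z) / 2 * v) = - (z * v) / 2 + - v / 2 by field.
rewrite expRD.
have P2 : 2 `^ p != 0 :> R by rewrite gt_eqF ?powR_gt0.
have P3 : 2 `^ q != 0 :> R by rewrite gt_eqF ?powR_gt0.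
have G1 : Gamma (p + 1) != 0 by rewrite gt_eqF ?Gamma_gt0 ?addr_gt0.
have G2 : Gamma q != 0 by rewrite gt_eqF ?Gamma_gt0.
move: P2 P3 G1 G2; rewrite /= ?mulrA.
move: (expR _) (expR _) (v `^ p) (v `^ (q - 1)) (z `^ p) => a1 a2 a3 a4 a5.
move: (2 `^ p) (2 `^ q) (Gamma (p + 1)) (Gamma q) => a6 a7 a8 a9.
by move=> P2 P3 G1 G2; field; rewrite P2 P3 G1 G2.
Qed.

Lemma chi_square_ratio_cdf_le (R : realType) nu (z : R) k :
  (0 < nu)%N -> (0 < k)%N -> 0 < z ->
  (chi_square_ratio_cdf nu z k <=
   (2 `^ (nu%:R / 2) * (1 + (2 * z)^-1) `^ (- (k%:R / 2)))%:E)%E.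
Proof.
move=> nu0 k0 z0.
(* any t below 1 / (2 z) keeps the expectation of e^(t z V) finite *)
pose t := (4 * z)^-1; have t0 : 0 < t by rewrite invr_gt0 mulr_gt0.
have -> : 1 + (2 * z)^-1 = 1 + 2 * t by rewrite /t; field; exact/lt0r_neq0.
have -> : 2 `^ (nu%:R / 2) = (1 + 2 * (- (1 / 4))) `^ (- (nu%:R / 2)) :> R.
  by rewrite -powRVl; [congr (_ `^ _); field|lra].
rewrite mulrC EFinM -(@chi_square_laplace _ nu (- (1 / 4)))//; last lra.
have me : measurable_fun [set: R] (fun q => (expR (- (- (1 / 4) * q)))%:E).
  apply/measurable_EFinP; apply: measurableT_comp => //.
  by apply: measurableT_comp => //; exact: measurable_funM.
rewrite -ge0_integralZl//=; last 3 first.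
- exact: (measurable_chi_square_pdf_mule nu me).
- by move=> q _; rewrite mule_ge0// lee_fin ?chi_square_pdf_ge0 ?expR_ge0.
- by rewrite lee_fin powR_ge0.
apply: ge0_le_integral => //=.
- by move=> v _; rewrite mule_ge0// ?chi_square_cdf_ge0// lee_fin chi_square_pdf_ge0.
- apply: measurable_chi_square_pdf_mule.
  by apply: (measurableT_comp (@measurable_chi_square_cdf R k)); exact: measurable_funM.
- exact: measurable_funeM (measurable_chi_square_pdf_mule nu me).
move=> v _; rewrite muleCA lee_wpmul2l ?lee_fin ?chi_square_pdf_ge0//.
apply: le_trans (chi_square_cdf_le _ k0 (ltW t0)) _.
rewrite -EFinM mulrC.
have -> : t * (z * v) = - (- (1 / 4) * v) by rewrite /t; field; exact/lt0r_neq0.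
by [].
Qed.

(** The remainder of the iterated recursion decays geometrically by
    [chi_square_ratio_cdf_le]. *)
Lemma chi_square_ratio_series (R : realType) nu (z : R) k :
  (0 < nu)%N -> (0 < k)%N -> 0 < z ->
  (\sum_(i <oo) (ratio_term nu z (k + i.*2))%:E = chi_square_ratio_cdf nu z k)%E.
Proof.
move=> nu0 k0 z0.
have G0 l : (0 <= chi_square_ratio_cdf nu z l)%E.
  apply: integral_ge0 => v _.
  by rewrite mule_ge0// ?chi_square_cdf_ge0// lee_fin chi_square_pdf_ge0.
have fG n : chi_square_ratio_cdf nu z (k + n.*2) \is a fin_num.
  rewrite ge0_fin_numE//; apply: le_lt_trans (chi_square_ratio_cdf_le nu0 _ z0) (ltry _).
  by rewrite addn_gt0 k0.
pose g n := fine (chi_square_ratio_cdf nu z (k + n.*2)).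
have gS n : g n = g n.+1 + ratio_term nu z (k + n.*2).
  rewrite /g (chi_square_ratio_cdf_rec nu0 _ z0) ?addn_gt0 ?k0//.
  have -> : (k + n.*2 + 2 = k + n.+1.*2)%N by rewrite doubleS -addnA addn2.
  by rewrite fineD.
have g0 : g n @[n --> \oo] --> (0 : R).
  set rho := 1 + (2 * z)^-1.
  have rho1 : 1 < rho by rewrite ltrDl invr_gt0 mulr_gt0.
  pose M : R := 2 `^ (nu%:R / 2) * rho `^ (- (k%:R / 2)).
  apply: (@squeeze_cvgr _ _ _ _ (cst 0) (fun n => M * rho^-1 ^+ n)).
  - apply: nearW => n; rewrite fine_ge0//= -lee_fin fineK//.
    apply: le_trans (chi_square_ratio_cdf_le nu0 _ z0) _; first by rewrite addn_gt0 k0.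
    rewrite lee_fin /M -mulrA; apply/ler_wpM2l; first exact: powR_ge0.
    rewrite -/rho -powR_mulrn ?invr_ge0 ?powRVl; try by apply: ltW; lra.
    rewrite -powRD; last by rewrite (gt_eqF (lt_trans ltr01 rho1)) implybT.
    rewrite -muln2 natrD natrM.
    by have -> : - ((k%:R + n%:R * 2) / 2) = - (k%:R / 2) + - n%:R :> R by field.
  - exact: cvg_cst.
  - rewrite -(mulr0 M); apply: cvgMr; apply: cvg_expr.
    by rewrite ger0_norm ?invr_ge0 ?invf_lt1//; lra.
rewrite -{2}[k]addn0 -{1}double0 -[RHS](fineK (fG 0%N)); apply: nneseries_EFin.
exact: cvg_series_telescope gS g0.
Qed.

(** The inequality q / v <= z, for z >= 0, without division: as q / 0 = 0, it holds at
    v = 0. *)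
Definition ratio_le (R : realType) (z v q : R) : bool :=
  if 0 < v then q <= z * v else (0 <= v) || (z * v <= q).

Lemma ratio_leE (R : realType) (z v q : R) : 0 <= z -> ratio_le z v q = (q / v <= z).
Proof.
move=> z0; rewrite /ratio_le; case: (ltgtP 0 v) => v0 /=.
- by rewrite ler_pdivrMr.
- by rewrite ler_ndivrMr.
- by rewrite -v0 invr0 mulr0 z0.
Qed.

Lemma measurable_ratio_le (R : realType) (z : R) :
  measurable_fun [set: R * R] (fun p : R * R => ratio_le z p.1 p.2).
Proof.
apply: measurable_fun_ifT.
- exact: measurable_fun_ltr.
- by apply: measurable_fun_ler => //; exact: measurable_funM.
- apply: measurable_or; first exact: measurable_fun_ler.
  by apply: measurable_fun_ler => //; exact: measurable_funM.
Qed.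

Lemma measurable_ratio_event d (T : measurableType d) (R : realType)
    (V Q : T -> R) (z : R) :
  measurable_fun [set: T] V -> measurable_fun [set: T] Q -> 0 <= z ->
  measurable [set w | Q w / V w <= z].
Proof.
move=> mV mQ z0.
have mp : measurable_fun [set: T] (fun w => ratio_le z (V w) (Q w)).
  have mVQ : measurable_fun [set: T] (fun w => (V w, Q w)) by exact: measurable_fun_pair.
  exact: measurableT_comp (measurable_ratio_le z) mVQ.
rewrite (_ : [set w | _] = [set: T] `&` (fun w => ratio_le z (V w) (Q w)) @^-1` [set true]).
  exact: mp.
by apply/seteqP; split => w /=; [rewrite ratio_leE|move=> [_]; rewrite ratio_leE].
Qed.

Lemma probability_ratio_le d (T : measurableType d) (R : realType)
    (P : probability T R) (V : {RV P >-> R}) (Q : T -> R) (c : nat -> R)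
    (nu k : nat) (z : R) :
  measurable_fun [set: T] Q -> independent_pair P V Q ->
  is_chi_square nu V -> chi_square_mixture P Q c k -> (forall l, 0 <= c l) ->
  0 <= z ->
  (P [set w | Q w / V w <= z]%R =
   \sum_(l <oo) ((c l)%:E * chi_square_ratio_cdf nu z (k + l.*2)))%E.
Proof.
move=> mQ indVQ Vnu Qc c0 z0.
have mV : measurable_fun [set: T] V by [].
have mA := measurable_ratio_event mV mQ z0.
set A := [set w | _] in mA *.
pose f (p : R * R) : \bar R := ((ratio_le z p.1 p.2)%:R)%:E.
have f0 p : (0 <= f p)%E by rewrite lee_fin.
have mf : measurable_fun [set: R * R] f.
  apply/measurable_EFinP.
  rewrite (_ : (fun _ => _) = fun p : R * R => if ratio_le z p.1 p.2 then 1 else 0).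
    by apply: measurable_fun_ifT => //; exact: measurable_ratio_le.
  by apply/funext => p; case: ifP.
transitivity (\int[P]_w f (V w, Q w))%E.
  rewrite -[X in P X]setIT -integral_indic//; apply: eq_integral => w _.
  by rewrite indicE /f/= ratio_leE// /A mem_setE.
rewrite integral_independent_pair//.
pose J l (v : R) := (\int[lebesgue_measure]_q ((chi_square_pdf (k + l.*2) q)%:E * f (v, q)))%E.
have J0 l v : (0 <= J l v)%E.
  by apply: integral_ge0 => q _; rewrite mule_ge0// lee_fin chi_square_pdf_ge0.
have mJ l : measurable_fun [set: R] (J l).
  apply: (@measurable_fun_fubini_tonelli_F _ _ _ _ _ lebesgue_measure
    (fun p : R * R => (chi_square_pdf (k + l.*2) p.2)%:E * f p)%E).
    apply: emeasurable_funM => //.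
    apply/measurable_EFinP; apply: measurableT_comp => //.
    exact: measurable_chi_square_pdf.
  by move=> p; rewrite mule_ge0// lee_fin chi_square_pdf_ge0.
transitivity (\int[P]_w \sum_(l <oo) ((c l)%:E * J l (V w)))%E.
  apply: eq_integral => w _; apply: (Qc (fun q => f (V w, q))) => //.
  exact: measurableT_comp.
rewrite integral_nneseries//; last 2 first.
- move=> l; apply: measurable_funeM; exact: measurableT_comp.
- by move=> l w _; rewrite mule_ge0// lee_fin.
apply: eq_eseriesr => l _; rewrite ge0_integralZl//=; last 2 first.
- exact: measurableT_comp.
- by rewrite lee_fin.
congr (_ * _)%E; apply: etrans (chi_square_expectation Vnu (mJ l) (J0 l)) _.
apply: eq_integral => v _; have [v0|v0] := ltP 0 v; last first.
  have -> : chi_square_pdf nu v = 0 by rewrite /chi_square_pdf ltNge v0.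
  have e0 (x1 x2 : \bar R) : (0%:E * x1 = 0%:E * x2)%E by rewrite !mul0e.
  exact: e0.
congr (_ * _)%E; apply: eq_integral => q _; congr (_ * _)%E.
by rewrite /f/= /ratio_le v0.
Qed.

(** By [probability_ratio_le] and [chi_square_ratio_series] the probability is a double
    series, the Cauchy product of c with the constant sequence 1. *)
Lemma probability_ratio_le_series d (T : measurableType d) (R : realType)
    (P : probability T R) (V : {RV P >-> R}) (Q : T -> R) (c : nat -> R)
    (nu k : nat) (z : R) :
  measurable_fun [set: T] Q -> independent_pair P V Q ->
  is_chi_square nu V -> chi_square_mixture P Q c k -> (forall l, 0 <= c l) ->
  (0 < nu)%N -> (0 < k)%N -> 0 < z ->
  series (fun j => ratio_term nu z (k + j.*2) * \sum_(0 <= i < j.+1) c i) @ \oo -->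
  fine (P [set w | Q w / V w <= z]).
Proof.
move=> mQ indVQ Vnu Qc c0 nu0 k0 z0.
have mV : measurable_fun [set: T] V by [].
have mA := measurable_ratio_event mV mQ (ltW z0).
apply: nneseries_EFin_cvg.
  by move=> j; rewrite mulr_ge0 ?ratio_term_ge0 ?sumr_ge0.
rewrite fineK; last exact: fin_num_measure.
rewrite (probability_ratio_le mQ indVQ Vnu Qc c0 (ltW z0)).
pose h n : \bar R := (ratio_term nu z (k + n.*2))%:E.
transitivity (\sum_(l <oo) ((c l)%:E * \sum_(i <oo) (1%:E * h (l + i)%N)))%E.
  rewrite (@nneseries_cauchy_prod _ c (fun=> 1) h)//; last first.
    by move=> n; rewrite lee_fin ratio_term_ge0.
  apply: eq_eseriesr => n _; rewrite /h -EFinM mulrC; congr (_ * _)%:E.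
  by rewrite /cauchy_prod; apply: eq_bigr => i _; rewrite mulr1.
apply: eq_eseriesr => l _; congr (_ * _)%E.
rewrite -chi_square_ratio_series ?addn_gt0 ?k0//.
by apply: eq_eseriesr => i _; rewrite mul1e /h doubleD addnA.
Qed.

(** * Truncation of the series *)

Lemma ratio_termE (R : realType) (a y : R) N nu j :
  (0 < N)%N -> (0 < nu)%N -> 0 < a -> 0 < y ->
  ratio_term nu (y / a) (N + j.*2) =
  prefactor a N nu y * poch_ratio R N nu j * tfun a y ^+ j.
Proof.
move=> N0 nu0 a0 y0.
have p0 : 0 < N%:R / 2 :> R by rewrite divr_gt0// ltr0n.
have q0 : 0 < nu%:R / 2 :> R by rewrite divr_gt0// ltr0n.
rewrite /ratio_term /prefactor /B0 /B1 /poch_ratio /tfun.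
have -> : (N + j.*2)%:R / 2 = N%:R / 2 + j%:R :> R by rewrite -muln2 natrD natrM; field.
have -> : (nu%:R + (N + j.*2)%:R) / 2 = (nu%:R + N%:R) / 2 + j%:R :> R.
  by rewrite -muln2 natrD natrM; field.
have -> : (N%:R - 2) / 2 = N%:R / 2 - 1 :> R by field.
have -> : (nu%:R + N%:R) / 2 = N%:R / 2 + nu%:R / 2 :> R by field.
move: p0 q0; move: (N%:R / 2) (nu%:R / 2) => p q p0 q0.
rewrite (addrAC p j%:R 1) (Gamma_pochhammer j (addr_gt0 p0 q0)).
rewrite (Gamma_pochhammer j (addr_gt0 p0 ltr01)) GammaS//.
have ay0 : 0 < a + y by exact: addr_gt0.
have -> : 1 + y / a = (a + y) / a by field; exact/lt0r_neq0.
have zj : (y / a) `^ (p + j%:R) / ((a + y) / a) `^ (p + q + j%:R) =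
    a `^ q * (y * y `^ (p - 1)) / (a + y) `^ (p + q) * (y / (a + y)) ^+ j.
  have split_pow (x r : R) : 0 < x -> x `^ (r + j%:R) = x `^ r * x ^+ j.
    by move=> x0; rewrite powRD ?(gt_eqF x0) ?implybT// powR_mulrn// ltW.
  rewrite mulr_powRB1//; last exact: ltW.
  rewrite !split_pow ?divr_gt0// !(powRM _ (ltW _)) ?invr_ge0 ?(ltW a0) ?(ltW y0)//.
  rewrite !powRVl ?(ltW a0)// !powRN (@powRD _ a p q); last by rewrite (gt_eqF a0) implybT.
  rewrite !expr_div_n.
  have := lt0r_neq0 (powR_gt0 p a0); have := lt0r_neq0 (powR_gt0 q a0).
  have := lt0r_neq0 (powR_gt0 (p + q) ay0).
  have : a ^+ j != 0 by rewrite expf_neq0 ?gt_eqF.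
  have : (a + y) ^+ j != 0 by rewrite expf_neq0 ?gt_eqF.
  move: (_ `^ (p + q)) (a `^ q) (a `^ p) (y `^ p) ((a + y) ^+ j) (a ^+ j) (y ^+ j).
  by move=> a1 a2 a3 a4 a5 a6 a7 h1 h2 h3 h4 h5; field; rewrite h1 h2 h3 h4 h5.
rewrite zj.
have := lt0r_neq0 (Gamma_gt0 p0); have := lt0r_neq0 (Gamma_gt0 q0).
have := lt0r_neq0 (pochhammer_gt0 j (addr_gt0 p0 (@ltr01 R))).
have := lt0r_neq0 (powR_gt0 (p + q) ay0); have := lt0r_neq0 p0.
move: (_ `^ (p + q)) (a `^ q) (y `^ (p - 1)) ((y / (a + y)) ^+ j) (Gamma (p + q)).
move: (pochhammer (p + q) j) (pochhammer (p + 1) j) (Gamma p) (Gamma q).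
move=> a1 a2 a3 a4 a5 a6 a7 a8 a9 h1 h2 h3 h4 h5.
by field; rewrite h1 h2 h3 h4 h5.
Qed.

(** The factor (1)_j of the hypergeometric series cancels j!, and the shifted Pochhammer
    symbols extend those of index tau + 1. *)
Lemma hypergeo_tail_cvg (R : realType) (a y : R) N nu tau :
  (0 < N)%N -> (0 < nu)%N -> 0 < a -> 0 < y ->
  let D k := prefactor a N nu y * poch_ratio R N nu k * tfun a y ^+ k in
  cvgn (series D) ->
  series (fun k => D (tau.+1 + k)%N) @ \oo --> hypergeo_tail a N nu tau y.
Proof.
move=> N0 nu0 a0 y0 D /cvg_ex[/= l Dl].
pose K := prefactor a N nu y * poch_ratio R N nu tau.+1 * tfun a y ^+ tau.+1.
have p0 : 0 < N%:R / 2 :> R by rewrite divr_gt0// ltr0n.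
have q0 : 0 < nu%:R / 2 :> R by rewrite divr_gt0// ltr0n.
have K0 : K != 0.
  rewrite /K -ratio_termE// /ratio_term.
  have z0 : 0 < y / a by exact: divr_gt0.
  apply/lt0r_neq0/mulr_gt0; last by rewrite divr_gt0 ?powR_gt0 ?addr_gt0.
  have c0 : 0 < (nu%:R + (N + tau.+1.*2)%:R) / 2 :> R.
    by rewrite divr_gt0// ltr_wpDr// ltr0n.
  have c1 : 0 < (N + tau.+1.*2)%:R / 2 + 1 :> R by rewrite ltr_wpDl// divr_ge0.
  by rewrite divr_gt0 ?mulr_gt0 ?Gamma_gt0.
rewrite /hypergeo_tail -/K /hypergeo2F1.
pose v k := pochhammer ((nu%:R + N%:R) / 2 + tau%:R + 1) k * pochhammer 1 k /
  (pochhammer (N%:R / 2 + tau%:R + 2) k * k`!%:R) * tfun a y ^+ k.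
rewrite -/v.
have DE : (fun k => D (tau.+1 + k)%N) = fun k => K * v k.
  apply/funext => k; rewrite /D /K /v /poch_ratio exprD !pochhammerD pochhammer1.
  have -> : (nu%:R + N%:R) / 2 + tau%:R + 1 = (nu%:R + N%:R) / 2 + tau.+1%:R :> R.
    by rewrite -addrA natr1.
  have -> : N%:R / 2 + tau%:R + 2 = N%:R / 2 + 1 + tau.+1%:R :> R.
    by rewrite -[tau.+1]addn1 natrD; ring.
  have F0 : k`!%:R != 0 :> R by rewrite pnatr_eq0 -lt0n fact_gt0.
  have s0 : 0 < N%:R / 2 + 1 :> R by exact: addr_gt0.
  have := lt0r_neq0 (pochhammer_gt0 tau.+1 s0).
  have st0 : 0 < N%:R / 2 + 1 + tau.+1%:R :> R by exact: addr_gt0.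
  have := lt0r_neq0 (pochhammer_gt0 k st0).
  move: F0; rewrite exprS.
  move: (prefactor _ _ _ _) (pochhammer _ tau.+1) (pochhammer _ tau.+1).
  move: (pochhammer _ k) (pochhammer _ k).
  by move=> a1 a2 a3 a4 a5 h1 h2 h3; field; rewrite h1 h2 h3.
have := cvg_series_shift (n := tau.+1) Dl; rewrite DE.
pose L := l - \sum_(0 <= k < tau.+1) D k.
rewrite -/L => KL.
have vL : series v @ \oo --> K^-1 * L.
  rewrite (_ : series v = fun n => K^-1 * series (fun k => K * v k) n).
    by apply: cvgMr; exact: KL.
  apply/funext => n; rewrite /series/= mulr_sumr; apply: eq_bigr => k _.
  by rewrite mulKf.
by rewrite (cvg_lim _ vL)// mulVKf.
Qed.

(** The error is the sum over k > tau of D k (1 - S k), where S k is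
    c 0 + ... + c k, and 0 <= 1 - S k <= 1 - S (tau + 1). *)
Lemma truncation_bound (R : realType) (c D : nat -> R) (pr tail : R) tau :
  (forall k, 0 <= c k) -> (forall k, 0 <= D k) -> series c @ \oo --> (1 : R) ->
  series (fun k => D k * \sum_(0 <= i < k.+1) c i) @ \oo --> pr ->
  series (fun k => D (tau.+1 + k)%N) @ \oo --> tail ->
  `| pr - (\sum_(0 <= k < tau.+1) D k * (\sum_(0 <= i < k.+1) c i) + tail) |
    <= (1 - \sum_(0 <= i < tau.+2) c i) * tail.
Proof.
move=> c0 D0 c1 prl taill.
set S := fun k => \sum_(0 <= i < k) c i.
have S1 k : S k <= 1 by exact: nondecreasing_series_le c1.
have Smono : {homo S : i j / (i <= j)%N >-> i <= j}.
  by apply/nondecreasing_seqP => k; rewrite /S big_nat_recr//= lerDl.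
pose e k := D (tau.+1 + k)%N * (1 - S (tau.+1 + k).+1).
have el : series e @ \oo --> tail - (pr - \sum_(0 <= k < tau.+1) D k * S k.+1).
  have := cvg_series_shift (n := tau.+1) prl => h.
  rewrite (_ : series e = series (fun k => D (tau.+1 + k)%N) -
      series (fun k => D (tau.+1 + k)%N * S (tau.+1 + k).+1)); first exact: cvgB.
  apply/funext => n; rewrite fctE /series/= -sumrB; apply: eq_bigr => k _.
  by rewrite /e mulrBr mulr1.
have e0 k : 0 <= e k by rewrite mulr_ge0// subr_ge0.
have lb : 0 <= tail - (pr - \sum_(0 <= k < tau.+1) D k * S k.+1).
  by have := nondecreasing_series_le 0 e0 el; rewrite /series/= big_nil.
have ub : tail - (pr - \sum_(0 <= k < tau.+1) D k * S k.+1) <= (1 - S tau.+2) * tail.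
  have tl : series (fun k => (1 - S tau.+2) * D (tau.+1 + k)%N) @ \oo --> (1 - S tau.+2) * tail.
    rewrite (_ : series _ = fun n => (1 - S tau.+2) * series (fun k => D (tau.+1 + k)%N) n).
      exact: cvgMr.
    by apply/funext => n; rewrite /series/= mulr_sumr.
  rewrite -(cvg_lim _ el)// -(cvg_lim _ tl)//; apply: ler_lim; [exact/cvgP/el|exact/cvgP/tl|].
  apply: nearW => n; apply: ler_sum => k _; rewrite /e mulrC ler_wpM2r// lerB//.
  by apply: Smono; rewrite !ltnS leq_addr.
rewrite -normrN ger0_norm; first by move: ub; rewrite /S; lra.
by move: lb; rewrite /S; lra.
Qed.

(* The number r >= 2 of chi-square summands is n.+2. *)

Theorem theorem4 (R : realType) (d : measure_display) (T : measurableType d)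
    (P : probability T R) (n : nat)
    (alpha : 'I_n.+2 -> R) (m : 'I_n.+2 -> nat) (nu : nat)
    (X : 'I_n.+2 -> {RV P >-> R}) (V : {RV P >-> R})
    (c : nat -> R) (tau : nat) (y : R)
    (alpha_decr : forall i j : 'I_n.+2, (i < j)%N -> alpha j < alpha i)
    (alpha_gt0 : forall i : 'I_n.+2, 0 < alpha i)
    (m_gt0 : forall i : 'I_n.+2, (0 < m i)%N)
    (nu_gt0 : (0 < nu)%N)
    (XV_indep : mutually_independent
                  (fun o : option 'I_n.+2 => if o is Some i then X i else V))
    (X_chi2 : forall i : 'I_n.+2, is_chi_square (m i) (X i))
    (V_chi2 : is_chi_square nu V)
    (c_coefs : generating_coefs alpha m c)
    (y_gt0 : 0 < y) :
  let a := coef_a alpha m nu in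
  let N := total_df m in
  let W := Wstat alpha m nu X V in
  `| fine (P [set w | W w <= y]) - E_est a N nu c tau y |
    <= e_bound a N nu c tau y.
Proof.
set a := coef_a alpha m nu; set N := total_df m; set W := Wstat alpha m nu X V.
cbv zeta.
have N0 : (0 < N)%N by rewrite /N /total_df big_ord_recl addn_gt0 m_gt0.
have ar0 : 0 < alpha ord_max by [].
have a0 : 0 < a by rewrite /a /coef_a divr_gt0 ?mulr_gt0 ?ltr0n.
have z0 : 0 < y / a by exact: divr_gt0.
(* V is kept in the family, as the index None; the list s selects the X i *)
pose XV (o : option 'I_n.+2) : {RV P >-> R} := if o is Some i then X i else V.
pose b (o : option 'I_n.+2) : R := if o is Some i then alpha i / alpha ord_max else 1.
pose df (o : option 'I_n.+2) : nat := if o is Some i then m i else nu.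
pose s := [seq Some i | i <- index_enum 'I_n.+2].
have b1 o : 1 <= b o.
  case: o => //= i; rewrite ler_pdivlMr// mul1r.
  have [->//|ni] := eqVneq i ord_max.
  apply/ltW/alpha_decr; rewrite ltn_neqAle ni/=; exact: leq_ord.
have df0 o : (0 < df o)%N by case: o.
have us : uniq s by rewrite map_inj_uniq ?index_enum_uniq// => i j [].
have sN : s != [::].
  have : Some ord0 \in s by rewrite map_f// mem_index_enum.
  by apply: contraTneq => ->.
pose Q w := \sum_(o <- s) b o * XV o w.
have mQ : measurable_fun [set: T] Q.
  by apply: measurable_sum => o; exact: measurable_funM.
have indVQ : independent_pair P V Q.
  apply: (@independent_pair_sum _ _ _ P _ XV b s None) => //.
  by apply/mapP => -[].
pose C := sum_weights b df s.
have C0 l : 0 <= C l by exact: sum_weights_ge0.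
have sdf : \sum_(o <- s) df o = N by rewrite big_map.
have chi2 o : o \in s -> is_chi_square (df o) (XV o) by move=> /mapP[i _ ->]; exact: X_chi2.
have mixQ : chi_square_mixture P Q C N.
  have := @chi_square_mixture_sum _ _ _ P _ XV b df s XV_indep chi2 df0 b1 us sN.
  by rewrite sdf.
have Cseries z : 0 <= z <= 1 -> series (fun l => C l * z ^+ l) @ \oo -->
    coef_A alpha m * \prod_i (1 - coef_u alpha i * z) `^ (- (m i)%:R / 2).
  move=> zr; apply: nneseries_EFin_cvg.
    by move=> l; rewrite mulr_ge0// exprn_ge0//; case/andP: zr.
  rewrite (sum_weights_series _ b1 df0 zr) big_map; congr (_%:E).
  rewrite -big_split; apply: eq_bigr => i _.
  by rewrite /b /df /coef_u invf_div !mulNr.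
have cC : c = C.
  apply/funext; apply: power_series_unique c_coefs _ => z /andP[z1 z2].
  by apply: Cseries; rewrite z1 ltW.
have C1 : series C @ \oo --> (1 : R).
  have := Cseries 1; rewrite ler01 lexx => /(_ isT).
  rewrite /coef_A -big_split big1/=; last first.
    move=> i _; have bi : 0 < alpha i / alpha ord_max by exact: divr_gt0.
    rewrite mulr1 /coef_u subKr -[X in _ * X `^ _]invf_div mulNr powRVl ?(ltW bi)// opprK.
    by rewrite -powRD ?addNr ?powRr0// (gt_eqF bi) implybT.
  by under eq_fun do rewrite expr1n mulr1.
have WE : [set w | W w <= y] = [set w | Q w / V w <= y / a].
  have QE w : Q w = (\sum_i alpha i * X i w) / alpha ord_max.
    rewrite /Q big_map mulr_suml; apply: eq_bigr => i _ /=.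
    by rewrite mulrAC.
  have WQ w : W w = a * (Q w / V w).
    rewrite /W /Wstat QE /a /coef_a -/N invf_div.
    (* V w may vanish: its inverse is treated as an indeterminate *)
    move: (\sum_i _) ((V w)^-1) => sX v.
    by field; rewrite ?(gt_eqF ar0) ?pnatr_eq0 -?lt0n ?N0 ?nu_gt0.
  by apply/seteqP; split => w /=; rewrite WQ ler_pdivlMr// mulrC.
rewrite WE.
have prl := probability_ratio_le_series mQ indVQ V_chi2 mixQ C0 nu_gt0 N0 z0.
pose D k := prefactor a N nu y * poch_ratio R N nu k * tfun a y ^+ k.
have DE k : ratio_term nu (y / a) (N + k.*2) = D k by exact: ratio_termE.
have D0 k : 0 <= D k by rewrite -DE ratio_term_ge0.
have Dcvg : cvgn (series D).
  apply/cvg_ex; exists (fine (chi_square_ratio_cdf nu (y / a) N)).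
  apply: nneseries_EFin_cvg => //; rewrite fineK; last first.
    rewrite ge0_fin_numE; last first.
      apply: integral_ge0 => v _.
      by rewrite mule_ge0// ?chi_square_cdf_ge0// lee_fin chi_square_pdf_ge0.
    exact: le_lt_trans (chi_square_ratio_cdf_le nu_gt0 N0 z0) (ltry _).
  rewrite -chi_square_ratio_series//.
  by apply: eq_eseriesr => k _; rewrite DE.
have taill := @hypergeo_tail_cvg _ a y N nu tau N0 nu_gt0 a0 y_gt0 Dcvg.
have prl' : series (fun k => D k * \sum_(0 <= i < k.+1) C i) @ \oo -->
    fine (P [set w | Q w / V w <= y / a]).
  by move: prl; under eq_fun do rewrite DE.
have := truncation_bound C0 D0 C1 prl' taill.
rewrite /E_est /e_bound /H_hat cC mulr_sumr.
by under [in X in _ -> X]eq_bigr do rewrite mulrA mulrA.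
Qed.
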